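(* Let $0<q<1$. For all $l,m,p\in\mathbb{Z}_+$, $\sigma,\tau\in\mathbb{R}$ and $x\in\mathbb{C}$, $$ \begin{aligned} &p^{(0,0)}_l(x;q^\tau,q^\sigma\mid q)\, l_m^{(p)}(x;q^\tau,q^\sigma\mid q) \\ &= \sum_{n=0}^l D^{n,l}(\tau,\sigma)\, P^{(n,n)}_{l-n}(-q^m;q^{2\tau},1;q)\, P^{(n,n)}_{l-n}(-q^{m+p};q^{2\sigma},1;q)\, l_{m+n}^{(p)}(x;q^\tau,q^\sigma\mid q) \\ &\quad+ \sum_{n=1}^l D^{n,l}(\tau,\sigma)\, (q^m,q^{m+p},-q^{m+p-2\sigma},-q^{m-2\tau};q^{-1})_n \\ &\qquad\qquad\times P^{(n,n)}_{l-n}(-q^{m-n};q^{2\tau},1;q)\, P^{(n,n)}_{l-n}(-q^{m+p-n};q^{2\sigma},1;q)\, l_{m-n}^{(p)}(x;q^\tau,q^\sigma\mid q), \end{aligned} $$ where $$ D^{n,l}(\tau,\sigma) = (-q^{2\sigma-l},-q^{2\tau-l};q)_{l-n}\, \frac{(q^{l-n+1};q)_n}{(q;q)_n}\, (q^{n+1};q)_l\; q^{\frac12 (l-n)(l-n-2\sigma-2\tau)} . $$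
   Context: $\mathbb{Z}_+=\{0,1,2,\ldots\}$ and $0<q<1$ is fixed. For a nonzero base $r$ (here $r=q$ or $r=q^{-1}$) put $(a;r)_k=\prod_{i=0}^{k-1}(1-ar^i)$ (empty product $=1$) and $(a_1,\ldots,a_j;r)_k=\prod_{i=1}^j(a_i;r)_k$. Basic hypergeometric series: $${}_{r+1}\varphi_r\left({a_1,\ldots,a_{r+1}\atop b_1,\ldots,b_r};q,z\right)=\sum_{k=0}^\infty\frac{(a_1,\ldots,a_{r+1};q)_k}{(q,b_1,\ldots,b_r;q)_k}z^k .$$ Askey-Wilson polynomials (polynomials of degree $n$ in $x=\cos\theta$, extended to all $x\in\mathbb{C}$): $$p_n(\cos\theta;a,b,c,d\mid q)=a^{-n}(ab,ac,ad;q)_n\;{}_4\varphi_3\left({q^{-n},abcdq^{n-1},ae^{i\theta},ae^{-i\theta}\atop ab,\ ac,\ ad};q,q\right).$$ The $q$-Jacobi case (for $\alpha=\beta=0$: the $q$-Legendre polynomials): $$p_n^{(\alpha,\beta)}(x;s,t\mid q)=p_n\bigl(x;q^{1/2+\alpha}s/t,\,q^{1/2}t/s,\,-q^{1/2}/(st),\,-stq^{1/2+\beta}\mid q\bigr).$$ The $q$-Laguerre case: $$l_n^{(\alpha)}(x;s,t\mid q)=p_n\bigl(x;q^{1/2+\alpha}s/t,\,q^{1/2}t/s,\,-q^{1/2}/(st),\,0\mid q\bigr).$$ Big $q$-Jacobi polynomials: $$P_n^{(\alpha,\beta)}(x;c,d;q)={}_3\varphi_2\left({q^{-n},\,q^{n+\alpha+\beta+1},\,q^{1+\alpha}x/c\atop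 q^{\alpha+1},\,-q^{1+\alpha}d/c};q,q\right).$$ In the second sum, terms with $n>m$ are read as $0$ (the factor $(q^m;q^{-1})_n$ vanishes). *)

(* Defs.v *)
From HB Require Import structures.
From mathcomp Require Import all_boot all_order all_algebra.
From mathcomp Require Import complex.
From mathcomp Require Import all_classical all_reals all_analysis.
From mathcomp Require Import ring.

Set Implicit Arguments.
Unset Strict Implicit.
Unset Printing Implicit Defensive.

Import Order.TTheory GRing.Theory Num.Theory.
Import numFieldNormedType.Exports.

Local Open Scope classical_set_scope.
Local Open Scope ring_scope.
Local Open Scope complex_scope.

Definition qpoch (F : fieldType) (a r : F) (k : nat) : F :=
  \prod_(i < k) (1 - a * r ^+ i).

Definition qpochs (F : fieldType) (s : seq F) (r : F) (k : nat) : F :=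
  \prod_(a <- s) qpoch a r k.

(* The sum to infinity is the limit of the partial sums. *)
Definition qhyper (F : numFieldType) (r : nat)
    (a : r.+1.-tuple F) (b : r.-tuple F) (q z : F) : F :=
  limn (series (fun k => qpochs a q k / qpochs (q :: b) q k * z ^+ k)).

(* [z] plays the role of e^{i theta}. The exponent n - 1 is an integer, since
   n may be 0. *)
Definition askey_wilson_exp (F : numFieldType) (n : nat) (z a b c d q : F) : F :=
  a ^- n * qpochs [:: a * b; a * c; a * d] q n *
  qhyper [tuple q ^- n; a * b * c * d * q ^ (n%:Z - 1); a * z; a * z^-1]
         [tuple a * b; a * c; a * d] q q.

(* [x + sqrtC (x ^+ 2 - 1)] is e^{i theta} for a theta with cos theta = x; every
   other choice gives the same value, see [askey_wilson_cos] below. *)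
Definition askey_wilson (F : numClosedFieldType) (n : nat) (x a b c d q : F) : F :=
  askey_wilson_exp n (x + sqrtC (x ^+ 2 - 1)) a b c d q.

Definition q_jacobi (R : realType) (n : nat) (alpha beta : R) (x : R[i])
    (s t q : R) : R[i] :=
  askey_wilson n x
    (q `^ (2^-1 + alpha) * s / t)%:C
    (q `^ 2^-1 * t / s)%:C
    (- (q `^ 2^-1 / (s * t)))%:C
    (- (s * t * q `^ (2^-1 + beta)))%:C
    q%:C.

Definition q_laguerre (R : realType) (n : nat) (alpha : R) (x : R[i])
    (s t q : R) : R[i] :=
  askey_wilson n x
    (q `^ (2^-1 + alpha) * s / t)%:C
    (q `^ 2^-1 * t / s)%:C
    (- (q `^ 2^-1 / (s * t)))%:C
    0
    q%:C.

Definition big_q_jacobi (R : realType) (n : nat) (alpha beta : R) (x : R[i])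
    (c d q : R) : R[i] :=
  qhyper [tuple q%:C ^- n; (q `^ (n%:R + alpha + beta + 1))%:C;
                (q `^ (1 + alpha))%:C * x / c%:C]
         [tuple (q `^ (alpha + 1))%:C; (- (q `^ (1 + alpha) * d / c))%:C]
         q%:C q%:C.

(* Meant for n <= l; the differences l - n are then those of natural numbers. *)
Definition linearization_coef (R : realType) (q : R) (n l : nat) (tau sigma : R) : R :=
  qpochs [:: - q `^ (2 * sigma - l%:R); - q `^ (2 * tau - l%:R)] q (l - n) *
  (qpoch (q ^+ (l - n + 1)) q n / qpoch q q n) *
  qpoch (q ^+ (n + 1)) q l *
  q `^ (2^-1 * (l - n)%:R * ((l - n)%:R - 2 * sigma - 2 * tau)).

Lemma qpoch_eq0 (F : fieldType) (q : F) (n k : nat) :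
  q != 0 -> (n < k)%N -> qpoch (q ^- n) q k = 0.
Proof.
move=> q0 nk; rewrite /qpoch (bigD1 (Ordinal nk)) //=.
by rewrite mulVf ?expf_neq0 // subrr mul0r.
Qed.

(* All the series involved terminate. *)
Lemma qhyper_terminating (F : numFieldType) (r n : nat)
    (a : r.+1.-tuple F) (b : r.-tuple F) (q z : F) :
  q != 0 -> q ^- n \in a ->
  qhyper a b q z =
  \sum_(k < n.+1) qpochs a q k / qpochs (q :: b) q k * z ^+ k.
Proof.
move=> q0 na; rewrite /qhyper; set u := fun k : nat => _.
have u0 k : (n < k)%N -> u k = 0.
  move=> nk; rewrite /u /qpochs (big_rem _ na) /= qpoch_eq0 //.
  by rewrite mul0r mul0r mul0r.
apply: (@cvg_lim F) => //.
apply: cvg_near_cst; near=> N.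
have nN : (n.+1 <= N)%N by near: N; exact: nbhs_infty_ge.
rewrite /series /= (@big_cat_nat _ _ _ n.+1) //= big_mkord.
rewrite [X in _ + X]big_nat_cond [X in _ + X]big1 ?addr0 //.
by move=> i /andP[/andP[ni _] _]; exact: u0.
Unshelve. all: by end_near. Qed.

Lemma askey_wilson_expV (F : numFieldType) (n : nat) (z a b c d q : F) :
  askey_wilson_exp n z^-1 a b c d q = askey_wilson_exp n z a b c d q.
Proof.
rewrite /askey_wilson_exp; congr (_ * _); rewrite /qhyper invrK.
congr (limn (series _)); apply/funext => k; congr (_ / _ * _).
by rewrite /qpochs !big_cons big_nil; ring.
Qed.

Lemma askey_wilson_cos (F : numClosedFieldType) (n : nat) (z a b c d q : F) :
  z != 0 ->
  askey_wilson n ((z + z^-1) / 2) a b c d q = askey_wilson_exp n z a b c d q.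
Proof.
move=> z0; rewrite /askey_wilson; set x := (z + z^-1) / 2.
set w := x + _.
have : (w - z) * (w - z^-1) = 0.
  have -> : (w - z) * (w - z^-1) = (w - x) ^+ 2 - (x ^+ 2 - 1).
    by rewrite /x; field; rewrite ?z0 ?pnatr_eq0.
  by rewrite /w addrAC subrr add0r sqrtCK subrr.
move/eqP; rewrite mulf_eq0 !subr_eq0 => /orP[/eqP-> //|/eqP->].
exact: askey_wilson_expV.
Qed.

(* Main.v *)
(** The q-Laguerre polynomials satisfy a three-term recurrence in m, so that
    multiplication by 2x = z + 1/z is a tridiagonal operator X on sequences indexed by m,
    symmetric after rescaling. A matrix that commutes with X is determined by its row
    m = 0, so it suffices that the matrix K of the coefficients of the theorem
    - commutes with X: K is symmetric for the same rescaling, so only the entries above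
      the diagonal matter. There K (m, m + n) is a product of two big q-Jacobi polynomials
      of degree l - n, in q^m and in q^(m+p), and the forward and backward shift relations
      express every term of the commutation relation by the pair of the polynomials of
      degrees l - n and l - n - 1 in each variable, which leaves a bilinear identity
      between rational functions;
    - has the right row m = 0: this is a connection formula. It is read off the expansions
      of both families in the basis attached to the common parameter
      c = - q^(1/2) / (s t), by q-binomial inversion. The change of base point in the
      Askey-Wilson polynomials comes from their recurrence, whose coefficients are symmetric
      in the parameters. *)
Require Import Defs.
From HB Require Import structures.
From mathcomp Require Import all_boot all_order all_algebra.
From mathcomp Require Import complex.
From mathcomp Require Import all_classical all_reals all_analysis.
From mathcomp Require Import ring zify.

Set Implicit Arguments.
Unset Strict Implicit.
Unset Printing Implicit Defensive.

Import Order.TTheory GRing.Theory Num.Theory.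
Local Open Scope ring_scope.
Local Open Scope complex_scope.

(** * Askey-Wilson polynomials *)

Lemma qpoch0 (F : fieldType) (a r : F) : qpoch a r 0 = 1.
Proof. by rewrite /qpoch big_ord0. Qed.

Lemma qpochSr (F : fieldType) (a r : F) k :
  qpoch a r k.+1 = qpoch a r k * (1 - a * r ^+ k).
Proof. by rewrite /qpoch big_ord_recr. Qed.

Lemma qpochSl (F : fieldType) (a r : F) k :
  qpoch a r k.+1 = (1 - a) * qpoch (a * r) r k.
Proof.
rewrite /qpoch big_ord_recl expr0 mulr1; congr (_ * _).
by apply: eq_bigr => i _; rewrite /= exprS mulrA.
Qed.

Lemma qpochD (F : fieldType) (a r : F) m n :
  qpoch a r (m + n) = qpoch a r m * qpoch (a * r ^+ m) r n.
Proof.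
elim: n => [|n IH]; first by rewrite addn0 qpoch0 mulr1.
by rewrite addnS !qpochSr IH exprD; ring.
Qed.

Lemma qpoch_neq0 (F : fieldType) (a r : F) k :
  (forall i, (i < k)%N -> 1 - a * r ^+ i != 0) -> qpoch a r k != 0.
Proof. by move=> h; apply/prodf_neq0 => i _; exact: h. Qed.

Lemma qpochs3 (F : fieldType) (a b c r : F) k :
  qpochs [:: a; b; c] r k = qpoch a r k * qpoch b r k * qpoch c r k.
Proof. by rewrite /qpochs !big_cons big_nil mulr1 !mulrA. Qed.

(** This is the only part of the series that depends on z; by [aw_basisS] it is a polynomial in z +
    1/z. *)
Definition aw_basis (F : fieldType) (z a q : F) k := qpoch (a * z) q k * qpoch (a / z) q k.

Lemma aw_basisS (F : fieldType) (z a q : F) k : z != 0 ->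
  aw_basis z a q k.+1 =
  (1 + a ^+ 2 * q ^+ k ^+ 2 - a * q ^+ k * (z + z^-1)) * aw_basis z a q k.
Proof. by move=> z0; rewrite /aw_basis !qpochSr; field. Qed.

Section AskeyWilsonRecurrence.
Variables (F : fieldType) (q z : F).
Hypothesis q0 : q != 0.
Hypothesis z0 : z != 0.
Hypothesis q1 : forall k, 1 - q ^+ k.+1 != 0.

(** The summand of the 4phi3. Writing abcd q^(n-1) as (abcd / q) q^n avoids an integer exponent. *)
Definition aw_term (a b c d : F) n k :=
  qpoch (q ^- n) q k * qpoch (a * b * c * d / q * q ^+ n) q k /
  (qpoch q q k * qpoch (a * b) q k * qpoch (a * c) q k * qpoch (a * d) q k) *
  q ^+ k * aw_basis z a q k.

Definition aw_poly (a b c d : F) n :=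
  a ^- n * (qpoch (a * b) q n * qpoch (a * c) q n * qpoch (a * d) q n) *
  \sum_(k < n.+1) aw_term a b c d n k.

Lemma aw_term_gt a b c d n k : (n < k)%N -> aw_term a b c d n k = 0.
Proof. by move=> nk; rewrite /aw_term qpoch_eq0 // !mul0r. Qed.

Lemma aw_term0 a b c d n : aw_term a b c d n 0 = 1.
Proof. by rewrite /aw_term /aw_basis !qpoch0 expr0 !(mul1r, mulr1, invr1). Qed.

Lemma aw_sum_widen a b c d n N : (n < N)%N ->
  \sum_(k < n.+1) aw_term a b c d n k = \sum_(k < N) aw_term a b c d n k.
Proof.
move=> nN; rewrite (big_ord_widen _ (fun k => aw_term a b c d n k) nN).
rewrite big_mkcond; apply: eq_bigr => i _; case: ifP => // /negbT.
by rewrite -leqNgt => /aw_term_gt ->.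
Qed.

(** With Q = q^n, [aw_up], [aw_diag] and [aw_down] are the coefficients of p_(n+1), p_n and p_(n-1)
    in 2x p_n. [aw_low] is the lower coefficient for the bare series, without the prefactor of
    [aw_poly]. *)
Definition aw_up (a b c d : F) (Q : F) :=
  let e := a * b * c * d / q in
  (1 - e * Q) / ((1 - e * Q ^+ 2) * (1 - e * Q ^+ 2 * q)).

Definition aw_down (a b c d : F) (Q : F) :=
  let e := a * b * c * d / q in
  (1 - Q) * (1 - a * b * (Q / q)) * (1 - a * c * (Q / q)) * (1 - a * d * (Q / q)) *
  (1 - b * c * (Q / q)) * (1 - b * d * (Q / q)) * (1 - c * d * (Q / q)) /
  ((1 - e * Q ^+ 2 / q) * (1 - e * Q ^+ 2)).

Definition aw_low (a b c d : F) (Q : F) :=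
  let e := a * b * c * d / q in
  a * ((1 - Q) * (1 - b * c * (Q / q)) * (1 - b * d * (Q / q)) * (1 - c * d * (Q / q)) /
      ((1 - e * Q ^+ 2 / q) * (1 - e * Q ^+ 2))).

Definition aw_diag (a b c d : F) (Q : F) :=
  a + a^-1 - a^-1 * aw_up a b c d Q * (1 - a * b * Q) * (1 - a * c * Q) * (1 - a * d * Q)
  - aw_low a b c d Q.

Section Recurrence.
Variables a b c d : F.
Hypothesis a0 : a != 0.
Hypothesis ab : forall k, 1 - a * b * q ^+ k != 0.
Hypothesis ac : forall k, 1 - a * c * q ^+ k != 0.
Hypothesis ad : forall k, 1 - a * d * q ^+ k != 0.
Hypothesis abcd : forall k, 1 - a * b * c * d / q * q ^+ k != 0.

Let qpochne0 x k : (forall k, 1 - x * q ^+ k != 0) -> qpoch x q k != 0.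
Proof. by move=> h; apply: qpoch_neq0. Qed.

Let qq k : qpoch q q k != 0.
Proof. by apply: qpoch_neq0 => i _; rewrite -exprS. Qed.

Let abcd_q k : q - a * b * c * d * q ^+ k != 0.
Proof.
have -> : q - a * b * c * d * q ^+ k = q * (1 - a * b * c * d / q * q ^+ k) by field.
by rewrite mulf_neq0.
Qed.

Let abcd_1 k : 1 - a * b * c * d * q ^+ k != 0.
Proof.
have -> : 1 - a * b * c * d * q ^+ k = 1 - a * b * c * d / q * q ^+ k.+1.
  by rewrite exprS; field.
exact: abcd.
Qed.

(** The two terms share the factors (q^(-n); q)_k and (e q^(n+1); q)_k with e = abcd / q. The
    remaining factors differ by a multiple of 1 - q^(k+1), which cancels against the denominator. *)
Lemma aw_term_diff n k :
  aw_term a b c d n.+1 k.+1 - aw_term a b c d n k.+1 =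
  - (1 - a * b * c * d / q * q ^+ n ^+ 2 * q) /
    (q ^+ n * (1 - a * b * c * d / q * q ^+ n)) *
  (1 - a * b * c * d / q * q ^+ n * q ^+ k) *
  aw_term a b c d n k * (1 + a ^+ 2 * q ^+ k ^+ 2 - a * q ^+ k * (z + z^-1)) /
  ((1 - a * b * q ^+ k) * (1 - a * c * q ^+ k) * (1 - a * d * q ^+ k)).
Proof.
rewrite /aw_term aw_basisS //.
have -> : qpoch (q ^- n.+1) q k.+1 = (1 - q ^- n.+1) * qpoch (q ^- n) q k.
  by rewrite qpochSl; congr (_ * qpoch _ _ _); rewrite exprS; field; rewrite q0 expf_neq0.
set e := a * b * c * d / q.
have e1 : qpoch (e * q ^+ n * q) q k =
    qpoch (e * q ^+ n) q k * (1 - e * q ^+ n * q ^+ k) / (1 - e * q ^+ n).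
  by rewrite -qpochSr qpochSl; field; exact: abcd.
have -> : qpoch (e * q ^+ n.+1) q k.+1 =
    qpoch (e * q ^+ n) q k * (1 - e * q ^+ n * q ^+ k) / (1 - e * q ^+ n) *
    (1 - e * q ^+ n * q * q ^+ k).
  by rewrite qpochSr exprSr mulrA e1.
rewrite !qpochSr.
have := qq k; have := qpochne0 k ab; have := qpochne0 k ac; have := qpochne0 k ad.
have := abcd n; rewrite -/e; have := ab k; have := ac k; have := ad k.
have := q1 k; have qn0 : q ^+ n != 0 by rewrite expf_neq0.
rewrite !exprS.
set pe := qpoch (e * _) q k; set pn := qpoch (q ^- n) q k.
set pq := qpoch q q k; set pb := qpoch (a * b) q k; set pc := qpoch (a * c) q k.
set pd := qpoch (a * d) q k; set phi := aw_basis _ _ _ _.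
clearbody pe pn pq pb pc pd phi.
move: (q ^+ k) (q ^+ n) qn0 => K Q Q0 n1 n2 n3 n4 n5 n6 n7 n8 n9.
clearbody e.
by field; rewrite z0 q0 Q0 n1 n2 n3 n4 n5 n6 n7 n8 n9.
Qed.

Lemma aw_term_shift n k :
  aw_term a b c d n k * (1 - a * b * c * d / q * q ^+ n * q ^+ k) * (1 - q ^- n.+1) =
  aw_term a b c d n.+1 k * (1 - q ^- n.+1 * q ^+ k) * (1 - a * b * c * d / q * q ^+ n).
Proof.
set e := a * b * c * d / q.
have h1 : qpoch (q ^- n.+1) q k * (1 - q ^- n.+1 * q ^+ k) = (1 - q ^- n.+1) * qpoch (q ^- n) q k.
  rewrite -qpochSr qpochSl; congr (_ * qpoch _ _ _).
  by rewrite exprS; field; rewrite q0 expf_neq0.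
have h2 : qpoch (e * q ^+ n) q k * (1 - e * q ^+ n * q ^+ k) =
    (1 - e * q ^+ n) * qpoch (e * q ^+ n.+1) q k.
  by rewrite -qpochSr qpochSl exprSr mulrA.
rewrite /aw_term -/e; set x := qpoch q q k * _ * _ * _; set y := aw_basis _ _ _ _.
transitivity ((1 - q ^- n.+1) * qpoch (q ^- n) q k *
   (qpoch (e * q ^+ n) q k * (1 - e * q ^+ n * q ^+ k)) / x * q ^+ k * y); first by ring.
by rewrite -h1 h2; ring.
Qed.

Lemma aw_termS n k :
  aw_term a b c d n k.+1 = aw_term a b c d n k *
  (q * (1 - q ^- n * q ^+ k) * (1 - a * b * c * d / q * q ^+ n * q ^+ k) *
  (1 + a ^+ 2 * q ^+ k ^+ 2 - a * q ^+ k * (z + z^-1)) /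
  ((1 - q ^+ k.+1) * (1 - a * b * q ^+ k) * (1 - a * c * q ^+ k) * (1 - a * d * q ^+ k))).
Proof.
rewrite /aw_term aw_basisS // !qpochSr -exprS.
have := qq k; have := qpochne0 k ab; have := qpochne0 k ac; have := qpochne0 k ad.
have := ab k; have := ac k; have := ad k; have := q1 k.
set e := a * b * c * d / q; rewrite !exprS.
move=> *; field; by do !(apply/andP; split) => //; rewrite expf_neq0.
Qed.

(** This compares the coefficients of basis element k + 1 in the recurrence of the series. Every
    term is a rational multiple of [aw_term a b c d n.+1 k]. *)
Lemma aw_term_recS n k :
  aw_term a b c d n.+1 k * (1 + a ^+ 2 * q ^+ k ^+ 2 - a * q ^+ k * (z + z^-1)) / (a * q ^+ k) =
  aw_term a b c d n.+1 k.+1 * (1 - q ^+ k.+1) * (1 - a ^+ 2 * q ^+ k.+1) / (a * q ^+ k.+1)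
  - a^-1 * aw_up a b c d (q ^+ n.+1) * (1 - a * b * q ^+ n.+1) * (1 - a * c * q ^+ n.+1) *
    (1 - a * d * q ^+ n.+1) * (aw_term a b c d n.+2 k.+1 - aw_term a b c d n.+1 k.+1)
  + aw_low a b c d (q ^+ n.+1) * (aw_term a b c d n.+1 k.+1 - aw_term a b c d n k.+1).
Proof.
rewrite !aw_term_diff aw_termS /aw_up /aw_low.
have n3 := abcd n.
have n1 : 1 - a * b * c * d / q * q ^+ n * q ^+ k != 0 by rewrite -mulrA -exprD; exact: abcd.
have n7 := q1 n.
have n0 : q ^+ n != 0 by rewrite expf_neq0.
have n8 : 1 - q ^- n.+1 != 0.
  have -> : 1 - q ^- n.+1 = - (1 - q ^+ n.+1) / q ^+ n.+1 by rewrite exprS; field; rewrite q0 n0.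
  by rewrite mulf_neq0 ?oppr_eq0 ?invr_eq0 ?expf_neq0.
have -> : aw_term a b c d n k = aw_term a b c d n.+1 k * (1 - q ^- n.+1 * q ^+ k) *
    (1 - a * b * c * d / q * q ^+ n) /
    ((1 - a * b * c * d / q * q ^+ n * q ^+ k) * (1 - q ^- n.+1)).
  by rewrite -aw_term_shift -[X in _ = X / _]mulrA mulfK ?mulf_neq0.
have a1 := ab k; have a2 := ac k; have a3 := ad k; have a4 := q1 k.
have k0 : q ^+ k != 0 by rewrite expf_neq0.
have m1 : q - a * b * c * d * q ^+ n * q ^+ k != 0 by rewrite -mulrA -exprD; exact: abcd_q.
have m2 := abcd_q n; have m3 := abcd_1 n.
have m4 : 1 - a * b * c * d * (q ^+ n * (q * q ^+ n)) != 0.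
  by rewrite -exprS -exprD; exact: abcd_1.
have m5 : 1 - a * b * c * d * (q ^+ n * q ^+ n) != 0 by rewrite -exprD; exact: abcd_1.
have m6 : 1 - a * b * c * d * (q ^+ n * (q * q ^+ n)) * q != 0.
  by rewrite -exprS -exprD -mulrA -exprSr; exact: abcd_1.
have m7 : q * q ^+ n - 1 != 0 by rewrite -exprS -opprB oppr_eq0.
move: a1 a2 a3 a4 k0 n0 m1 m2 m3 m4 m5 m6 m7 {n1 n3 n7 n8}.
rewrite !exprS; move: (q ^+ k) (q ^+ n) (aw_term _ _ _ _ _ _) => K Q w.
move=> a1 a2 a3 a4 k0 n0 m1 m2 m3 m4 m5 m6 m7.
by field; do ?(apply/andP; split) => //.
Qed.

(** Degree 0 is treated apart: [aw_low] has the factor 1 - Q, which is 0 at Q = 1, so there is no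
    lower term. *)
Lemma aw_term_rec0 k :
  aw_term a b c d 0 k * (1 + a ^+ 2 * q ^+ k ^+ 2 - a * q ^+ k * (z + z^-1)) / (a * q ^+ k) =
  aw_term a b c d 0 k.+1 * (1 - q ^+ k.+1) * (1 - a ^+ 2 * q ^+ k.+1) / (a * q ^+ k.+1)
  - a^-1 * aw_up a b c d 1 * (1 - a * b) * (1 - a * c) *
    (1 - a * d) * (aw_term a b c d 1 k.+1 - aw_term a b c d 0 k.+1).
Proof.
case: k => [|k]; last by rewrite aw_term_diff !(@aw_term_gt _ _ _ _ 0) // !(mulr0, mul0r) subrr.
rewrite !aw_term_diff [aw_term _ _ _ _ 0 1]aw_term_gt // /aw_up.
have n2 : 1 - a * b * c * d / q != 0 by rewrite -[X in 1 - X]mulr1; exact: (abcd 0).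
have n3 : 1 - a * b * c * d / q * q != 0 by exact: (abcd 1).
have := ab 0; have := ac 0; have := ad 0; rewrite !expr0 !mulr1 => a3 a2 a1.
move: (aw_term _ _ _ _ _ _) => w; rewrite divfK // in n3 *.
have n4 : q - a * b * c * d != 0.
  by have -> : q - a * b * c * d = q * (1 - a * b * c * d / q); [field | rewrite mulf_neq0].
by field; rewrite a3 a2 a1 z0 q0 n4 n3 a0.
Qed.

Lemma aw_basis_rec k : (z + z^-1 - a - a^-1) * aw_basis z a q k =
  ((1 - q ^+ k) * (1 - a ^+ 2 * q ^+ k) * aw_basis z a q k - aw_basis z a q k.+1) / (a * q ^+ k).
Proof.
by rewrite aw_basisS //; field; rewrite z0 a0 expf_neq0.
Qed.

Lemma aw_sum_recS n N : (n.+2 < N)%N ->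
  (z + z^-1 - a - a^-1) * \sum_(k < N) aw_term a b c d n.+1 k =
  a^-1 * aw_up a b c d (q ^+ n.+1) * (1 - a * b * q ^+ n.+1) * (1 - a * c * q ^+ n.+1) *
    (1 - a * d * q ^+ n.+1) *
    (\sum_(k < N) aw_term a b c d n.+2 k - \sum_(k < N) aw_term a b c d n.+1 k)
  - aw_low a b c d (q ^+ n.+1) *
    (\sum_(k < N) aw_term a b c d n.+1 k - \sum_(k < N) aw_term a b c d n k).
Proof.
move=> nN.
rewrite -!sumrB !mulr_sumr -sumrB; apply/eqP; rewrite -subr_eq0 -sumrB; apply/eqP.
(* Multiplication by z + 1/z - a - 1/a is bidiagonal in [aw_basis], and [g k.+1] is minus what
   summand k contributes to basis element k + 1. The difference of the two sides telescopes, and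
   [g N] is 0 because the terms of index above n + 1 vanish. *)
pose g k := if k is j.+1 then
  aw_term a b c d n.+1 j * (1 + a ^+ 2 * q ^+ j ^+ 2 - a * q ^+ j * (z + z^-1)) / (a * q ^+ j)
  else 0.
transitivity (\sum_(k < N) (g k - g k.+1)).
  apply: eq_bigr => -[k kN] _ /=.
  have bk : (z + z^-1 - a - a^-1) * aw_term a b c d n.+1 k =
    aw_term a b c d n.+1 k * (1 - q ^+ k) * (1 - a ^+ 2 * q ^+ k) / (a * q ^+ k)
    - g k.+1.
    rewrite /g {1}/aw_term mulrCA aw_basis_rec aw_basisS // /aw_term; ring.
  rewrite bk; case: k kN {bk} => [|k] kN.
    by rewrite /g /= !aw_term0 expr0 !subrr; ring.
  by rewrite /g (aw_term_recS n k); ring.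
rewrite -(big_mkord xpredT (fun k => g k - g k.+1)) -[LHS]opprK -sumrN.
under eq_bigr do rewrite opprB.
rewrite telescope_sumr // /g; case: N nN => // N nN.
by rewrite aw_term_gt // !mul0r subr0 oppr0.
Qed.

Lemma aw_sum_rec0 N : (1 < N)%N ->
  (z + z^-1 - a - a^-1) * \sum_(k < N) aw_term a b c d 0 k =
  a^-1 * aw_up a b c d 1 * (1 - a * b) * (1 - a * c) * (1 - a * d) *
    (\sum_(k < N) aw_term a b c d 1 k - \sum_(k < N) aw_term a b c d 0 k).
Proof.
move=> nN.
rewrite -!sumrB !mulr_sumr; apply/eqP; rewrite -subr_eq0 -sumrB; apply/eqP.
pose g k := if k is j.+1 then
  aw_term a b c d 0 j * (1 + a ^+ 2 * q ^+ j ^+ 2 - a * q ^+ j * (z + z^-1)) / (a * q ^+ j)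
  else 0.
transitivity (\sum_(k < N) (g k - g k.+1)).
  apply: eq_bigr => -[k kN] _ /=.
  have bk : (z + z^-1 - a - a^-1) * aw_term a b c d 0 k =
    aw_term a b c d 0 k * (1 - q ^+ k) * (1 - a ^+ 2 * q ^+ k) / (a * q ^+ k)
    - g k.+1.
    rewrite /g {1}/aw_term mulrCA aw_basis_rec aw_basisS // /aw_term; ring.
  rewrite bk; case: k kN {bk} => [|k] kN.
    by rewrite /g /= !aw_term0 expr0 !subrr; ring.
  by rewrite /g (aw_term_rec0 k); ring.
rewrite -(big_mkord xpredT (fun k => g k - g k.+1)) -[LHS]opprK -sumrN.
under eq_bigr do rewrite opprB.
rewrite telescope_sumr // /g; case: N nN => // N nN.
by rewrite aw_term_gt // !mul0r subr0 oppr0.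
Qed.

Lemma aw_poly_recS n :
  (z + z^-1) * aw_poly a b c d n.+1 =
  aw_up a b c d (q ^+ n.+1) * aw_poly a b c d n.+2 +
  aw_diag a b c d (q ^+ n.+1) * aw_poly a b c d n.+1 +
  aw_down a b c d (q ^+ n.+1) * aw_poly a b c d n.
Proof.
have h := aw_sum_recS (ltnSn n.+2).
rewrite /aw_poly !(@aw_sum_widen _ _ _ _ _ n.+3) //; last by rewrite ltnW.
move: h; set r2 := \sum_(k < _) aw_term _ _ _ _ n.+2 k.
set r1 := \sum_(k < _) aw_term _ _ _ _ n.+1 k.
set r := \sum_(k < _) aw_term _ _ _ _ n k => h.
(* The ratio of the prefactors of p_(n+1) and p_n turns [aw_low] into [aw_down]. *)
have -> : aw_down a b c d (q ^+ n.+1) =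
  a^-1 * (1 - a * b * q ^+ n) * (1 - a * c * q ^+ n) * (1 - a * d * q ^+ n) *
  aw_low a b c d (q ^+ n.+1).
  by rewrite /aw_down /aw_low exprS [q * _]mulrC mulfK //; move: (_^-1); move=> *; field.
rewrite /aw_diag.
set U := aw_up _ _ _ _ _ in h *; set L := aw_low _ _ _ _ _ in h *.
rewrite !qpochSr.
set pb := qpoch (a * b) q n; set pc := qpoch (a * c) q n; set pd := qpoch (a * d) q n.
transitivity (a ^- n.+1 *
   (pb * (1 - a * b * q ^+ n) * (pc * (1 - a * c * q ^+ n)) * (pd * (1 - a * d * q ^+ n))) *
   ((z + z^-1 - a - a^-1) * r1 + (a + a^-1) * r1)); first by ring.
rewrite h !exprS; clearbody U L r2 r1 r pb pc pd.
by field; rewrite expf_neq0 // a0.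
Qed.

Lemma aw_poly_rec0 :
  (z + z^-1) * aw_poly a b c d 0 =
  aw_up a b c d 1 * aw_poly a b c d 1 + aw_diag a b c d 1 * aw_poly a b c d 0.
Proof.
have h := aw_sum_rec0 (ltnSn 1).
rewrite /aw_poly !(@aw_sum_widen _ _ _ _ _ 2) //.
move: h; set r1 := \sum_(k < _) aw_term _ _ _ _ 1 k.
set r := \sum_(k < _) aw_term _ _ _ _ 0 k => h.
rewrite /aw_diag /aw_low subrr !mul0r mulr0 subr0.
set U := aw_up _ _ _ _ _ in h *.
rewrite !qpochSr !qpoch0.
transitivity ((z + z^-1 - a - a^-1) * r + (a + a^-1) * r); first by rewrite expr0 invr1; ring.
by rewrite h !expr0 expr1 invr1; clearbody U r r1; field.
Qed.
End Recurrence.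

(* The coefficients of the three-term recurrence are symmetric in the parameters. *)
Lemma aw_poly_swap a b c d n :
  a != 0 -> c != 0 ->
  (forall k, 1 - a * b * q ^+ k != 0) -> (forall k, 1 - a * c * q ^+ k != 0) ->
  (forall k, 1 - a * d * q ^+ k != 0) -> (forall k, 1 - c * b * q ^+ k != 0) ->
  (forall k, 1 - c * d * q ^+ k != 0) ->
  (forall k, 1 - a * b * c * d / q * q ^+ k != 0) ->
  aw_poly a b c d n = aw_poly c b a d n.
Proof.
move=> a0 c0 ab ac ad cb cd abcd.
have ca k : 1 - c * a * q ^+ k != 0 by rewrite [c * a]mulrC.
have E : c * b * a * d = a * b * c * d by ring.
have cbad k : 1 - c * b * a * d / q * q ^+ k != 0 by rewrite E.
have up Q : aw_up c b a d Q = aw_up a b c d Q by rewrite /aw_up E.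
have down Q : aw_down c b a d Q = aw_down a b c d Q.
  by rewrite /aw_down E; congr (_ / _); ring.
have up0 m : aw_up a b c d (q ^+ m) != 0.
  rewrite /aw_up mulf_neq0 // invr_eq0 mulf_neq0 //; first by rewrite -exprM.
  by rewrite -exprM -mulrA -exprSr.
(* At Q = 1 the denominator 1 - e / q of [aw_low] is not known to be nonzero, but its numerator
   vanishes; hence the separate case. *)
have diag0 : aw_diag c b a d 1 = aw_diag a b c d 1.
  rewrite /aw_diag /aw_low !subrr !mul0r !mulr0 !subr0 up /aw_up.
  have := abcd 0; have := abcd 1; rewrite expr0 expr1 mulr1 divfK // => h1 h2.
  have h3 : q - a * b * c * d != 0.
    by have -> : q - a * b * c * d = q * (1 - a * b * c * d / q); [field | rewrite mulf_neq0].
  by field; rewrite q0 h1 h3 a0 c0.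
have diagS m : aw_diag c b a d (q ^+ m.+1) = aw_diag a b c d (q ^+ m.+1).
  rewrite /aw_diag /aw_low up E /aw_up.
  have h1 k : 1 - a * b * c * d * q ^+ k != 0.
    have -> : 1 - a * b * c * d * q ^+ k = 1 - a * b * c * d / q * q ^+ k.+1.
      by rewrite exprS; field.
    exact: abcd.
  have m4 : 1 - a * b * c * d * (q ^+ m * (q * q ^+ m)) != 0.
    by rewrite -exprS -exprD; exact: h1.
  have m5 : 1 - a * b * c * d * (q ^+ m * q ^+ m) != 0 by rewrite -exprD; exact: h1.
  have m6 : 1 - a * b * c * d * (q ^+ m * (q * q ^+ m)) * q != 0.
    by rewrite -exprS -exprD -mulrA -exprSr; exact: h1.
  move: m4 m5 m6; rewrite !exprS; move: (q ^+ m) => Q m4 m5 m6.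
  by field; do ?(apply/andP; split).
have p0 : aw_poly c b a d 0 = aw_poly a b c d 0.
  by rewrite /aw_poly !expr0 !qpoch0 !big_ord1 !aw_term0.
suff : aw_poly a b c d n = aw_poly c b a d n /\ aw_poly a b c d n.+1 = aw_poly c b a d n.+1.
  by case.
elim: n => [|n [IH1 IH2]]; split => //.
  apply: (mulfI (up0 0)); apply: (addIr (aw_diag a b c d 1 * aw_poly a b c d 0)).
  by rewrite expr0 -aw_poly_rec0 // -p0 -diag0 -up aw_poly_rec0.
apply: (mulfI (up0 n.+1)); apply: (addIr (aw_diag a b c d (q ^+ n.+1) * aw_poly a b c d n.+1)).
apply: (addIr (aw_down a b c d (q ^+ n.+1) * aw_poly a b c d n)).
by rewrite -aw_poly_recS // IH1 IH2 -diagS -up -down aw_poly_recS.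
Qed.
End AskeyWilsonRecurrence.

(** * Inversion of q-binomial sums *)

Section Inversion.
Variables (F : fieldType) (q : F).
Hypothesis q0 : q != 0.
Hypothesis q1 : forall k, 1 - q ^+ k.+1 != 0.

Let qq k : qpoch q q k != 0.
Proof. by apply: qpoch_neq0 => i _; rewrite -exprS. Qed.

(** The closed form vanishes at N = k + 1, which is the case j = 0 of the orthogonality below. *)
Lemma qbinomial_partial_sum k N :
  \sum_(n < N.+1) qpoch (q ^- k.+1) q n / qpoch q q n * q ^+ k.+1 ^+ n =
  qpoch (q ^- k) q N / qpoch q q N * q ^+ k.+1 ^+ N.
Proof.
elim: N => [|N IH]; first by rewrite big_ord1 !qpoch0.
rewrite big_ord_recr /= IH.
have -> : qpoch (q ^- k.+1) q N.+1 = (1 - q ^- k.+1) * qpoch (q ^- k) q N.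
  by rewrite qpochSl; congr (_ * qpoch _ _ _); rewrite exprS; field; rewrite q0 expf_neq0.
have := qq N; have := q1 N; rewrite [qpoch (q ^- k) q N.+1]qpochSr [qpoch q q N.+1]qpochSr -exprS.
have k0 : q ^+ k != 0 by rewrite expf_neq0.
rewrite [q ^+ k.+1 ^+ N.+1]exprS !exprS => n1 n2.
by field; rewrite n1 n2 q0 k0.
Qed.

(** Induction on k with j general. For j > 0 the summand n = 0 vanishes, and in the others 1 -
    q^(-n) and 1 - q^n cancel up to a power of q, which leaves the sum for k - 1 and j - 1. *)
Lemma qbinomial_orthogonality k j :
  \sum_(n < k.+1) qpoch (q ^- k) q n / qpoch q q n * q ^+ k ^+ n * qpoch (q ^- n) q j =
  (k == j)%:R * (qpoch q q k / q ^+ k).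
Proof.
elim: k j => [|k IH] j.
  rewrite big_ord1 !qpoch0 !expr0 invr1 !mul1r.
  case: j => [|j]; first by rewrite qpoch0 mulr1.
  by rewrite qpochSl subrr mul0r mul0r.
case: j => [|j].
  rewrite mul0r -[RHS](mul0r (q ^+ k.+1 ^+ k.+1)).
  under eq_bigr do rewrite qpoch0 mulr1.
  rewrite qbinomial_partial_sum; congr (_ * _).
  by rewrite qpoch_eq0 // mul0r.
rewrite big_ord_recl /= expr0 invr1 qpochSl subrr !(mul0r, mulr0) add0r.
rewrite eqSS.
transitivity ((1 - q ^+ k.+1) / q * ((k == j)%:R * (qpoch q q k / q ^+ k))).
  rewrite -IH mulr_sumr; apply: eq_bigr => -[n nk] _ /=.
  rewrite /bump /= add1n.
  have -> : qpoch (q ^- k.+1) q n.+1 = (1 - q ^- k.+1) * qpoch (q ^- k) q n.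
    by rewrite qpochSl; congr (_ * qpoch _ _ _); rewrite exprS; field; rewrite q0 expf_neq0.
  have -> : qpoch (q ^- n.+1) q j.+1 = (1 - q ^- n.+1) * qpoch (q ^- n) q j.
    by rewrite qpochSl; congr (_ * qpoch _ _ _); rewrite exprS; field; rewrite q0 expf_neq0.
  have := qq n; have := q1 n; rewrite [qpoch q q n.+1]qpochSr -exprS.
  have k0 : q ^+ k != 0 by rewrite expf_neq0.
  have n0 : q ^+ n != 0 by rewrite expf_neq0.
  rewrite [q ^+ k.+1 ^+ n.+1]exprS ![q ^+ _.+1]exprS exprMn => n1 n2.
  move: (q ^+ k ^+ n) => Kn; move: n1 n2 k0 n0; move: (q ^+ k) (q ^+ n) => K N n1 n2 k0 n0.
  move: (qpoch N^-1 q j) (qpoch K^-1 q n) (qpoch q q n) n2 => u1 u2 u3 n2.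
  by field; rewrite n2 q0 n0 n1 k0.
rewrite qpochSr !exprS; move: (_%:R) (qpoch _ _ _) => u v.
by field; rewrite expf_neq0.
Qed.

(** The inner sums have the common bound M so that the two sums can be exchanged; their summands
    with j > n are 0. *)
Lemma qbinomial_inversion (f : nat -> F) k M : (k < M)%N ->
  \sum_(n < k.+1) qpoch (q ^- k) q n / qpoch q q n * q ^+ k ^+ n *
    (\sum_(j < M) qpoch (q ^- n) q j / qpoch q q j * q ^+ j * f j) = f k.
Proof.
move=> kM.
under eq_bigr do rewrite mulr_sumr.
rewrite exchange_big /= (bigD1 (Ordinal kM)) //= [X in _ + X]big1 => [|j jk].
  transitivity ((\sum_(n < k.+1) qpoch (q ^- k) q n / qpoch q q n * q ^+ k ^+ n *
      qpoch (q ^- n) q k) * (q ^+ k / qpoch q q k * f k)).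
    by rewrite addr0 mulr_suml; apply: eq_bigr => n _; ring.
  by rewrite qbinomial_orthogonality eqxx mul1r; field; rewrite qq expf_neq0.
transitivity ((\sum_(n < k.+1) qpoch (q ^- k) q n / qpoch q q n * q ^+ k ^+ n *
      qpoch (q ^- n) q j) * (q ^+ j / qpoch q q j * f j)).
  by rewrite mulr_suml; apply: eq_bigr => n _; ring.
rewrite qbinomial_orthogonality; case: eqP => [kj|_]; last by rewrite !mul0r.
by case/eqP: jk; apply: val_inj.
Qed.
End Inversion.

(** * Big q-Jacobi polynomials *)

Section BigQJacobi.
Variables (F : fieldType) (q S : F) (l : nat).
Hypothesis q0 : q != 0.
Hypothesis q1 : forall k, 1 - q ^+ k.+1 != 0.
Hypothesis S0 : S != 0.
Hypothesis qS : forall k, 1 + q ^+ k / S != 0.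

Let qq k : qpoch q q k != 0.
Proof. by apply: qpoch_neq0 => i _; rewrite -exprS. Qed.

Let qX n k : qpoch (q ^+ n.+1) q k != 0.
Proof. by apply: qpoch_neq0 => i _; rewrite -exprD addSn. Qed.

Let qA n k : qpoch (- (q ^+ n.+1 / S)) q k != 0.
Proof.
by apply: qpoch_neq0 => i _; rewrite mulNr opprK mulrAC -exprD.
Qed.

(** With q^n / q^l for q^(-(l-n)) and q^n q^(l+1) for q^(n+l+1), passing from n to n + 1 multiplies
    every Pochhammer argument that depends on n by q, without a truncated subtraction. *)
Definition bqj_coef n k :=
  qpoch (q ^+ n / q ^+ l) q k * qpoch (q ^+ n * q ^+ l.+1) q k /
  (qpoch q q k * qpoch (q ^+ n.+1) q k * qpoch (- (q ^+ n.+1 / S)) q k) * q ^+ k.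

(* [bqj n y] is P^{(n,n)}_{l-n}(-y; S, 1; q); the summands with l - n < k vanish. *)
Definition bqj n y :=
  \sum_(k < l.+1) bqj_coef n k * qpoch (- (q ^+ n.+1 / S) * y) q k.

(** [bqj_lam] and [bqj_mu] are the factors of the forward and the backward shift relation; the first
    vanishes at n = l. *)
Definition bqj_lam n :=
  q * (q ^+ n.+1 / S) * (1 - q ^+ n / q ^+ l) * (1 - q ^+ n * q ^+ l.+1) /
  ((1 - q ^+ n.+1) * (1 + q ^+ n.+1 / S)).

Definition bqj_mu n := (1 - (q ^+ n.+1)^-1) * (1 + q ^+ n.+1 / S).

Lemma bqj_coef0 n k : (n <= l)%N -> (l - n < k)%N -> bqj_coef n k = 0.
Proof.
move=> nl nk; rewrite /bqj_coef.
have -> : q ^+ n / q ^+ l = q ^- (l - n).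
  by rewrite -{1}(subnKC nl) exprD; field; rewrite !expf_neq0.
by rewrite qpoch_eq0 // !mul0r.
Qed.

Lemma bqj_coefS n k : bqj_coef n k.+1 = bqj_coef n.+1 k *
  (q * (1 - q ^+ n / q ^+ l) * (1 - q ^+ n * q ^+ l.+1) /
   ((1 - q ^+ k.+1) * (1 - q ^+ n.+1) * (1 + q ^+ n.+1 / S))).
Proof.
rewrite /bqj_coef [qpoch q q k.+1]qpochSr !qpochSl.
have -> : q ^+ n / q ^+ l * q = q ^+ n.+1 / q ^+ l by rewrite exprSr mulrAC.
have -> : q ^+ n * q ^+ l.+1 * q = q ^+ n.+1 * q ^+ l.+1 by rewrite [q ^+ n.+1]exprSr mulrAC.
have -> : q ^+ n.+1 * q = q ^+ n.+2 by rewrite -exprSr.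
have -> : - (q ^+ n.+1 / S) * q = - (q ^+ n.+2 / S) by rewrite mulNr mulrAC -exprSr.
rewrite opprK.
have := qq k; have := qX n.+1 k; have := qA n.+1 k; have := q1 k; have := q1 n; have := qS n.+1.
move: (qpoch _ _ _) => u1; move: (qpoch _ _ _) => u2; move: (qpoch _ _ _) => u3.
move: (qpoch _ _ _) => u4; move: (qpoch _ _ _) => u5.
rewrite ![q ^+ k.+1]exprS.
move: (1 - q ^+ n.+1) (1 + q ^+ n.+1 / S) => v1 v3.
move: (1 - q ^+ n / q ^+ l) (1 - q ^+ n * q ^+ l.+1) (q ^+ k) => v4 v5 K.
move=> n1 n2 n3 n4 n5 n6.
by field; do ?(apply/andP; split).
Qed.

Lemma bqj_l y : bqj l y = 1.
Proof.
rewrite /bqj big_ord_recl big1 => [|i _]; last by rewrite bqj_coef0 ?mul0r // subnn.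
by rewrite /bqj_coef !qpoch0 expr0 !(mulr1, invr1) addr0.
Qed.

(** The difference kills the constant summand, and (A y; q)_(k+1) - (A q y; q)_(k+1) equals - A y (1
    - q^(k+1)) (A q y; q)_k, which is a summand for n + 1. *)
Lemma bqj_forward n y : (n <= l)%N ->
  bqj n y - bqj n (q * y) = bqj_lam n * y * bqj n.+1 y.
Proof.
move=> nl; rewrite /bqj -sumrB big_ord_recl !qpoch0 subrr add0r.
transitivity (\sum_(k < l) bqj_lam n * y * (bqj_coef n.+1 k * qpoch (- (q ^+ n.+2 / S) * y) q k)).
  apply: eq_bigr => -[k kl] _ /=; rewrite /bump /= add1n -mulrBr.
  rewrite qpochSl [qpoch _ _ k.+1]qpochSr.
  have -> : - (q ^+ n.+1 / S) * y * q = - (q ^+ n.+2 / S) * y by rewrite [q ^+ n.+2]exprSr; ring.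
  have -> : - (q ^+ n.+1 / S) * (q * y) = - (q ^+ n.+2 / S) * y by rewrite [q ^+ n.+2]exprSr; ring.
  rewrite bqj_coefS /bqj_lam [q ^+ n.+2]exprS.
  have := q1 k; have := q1 n; have := qS n.+1.
  rewrite ![q ^+ k.+1]exprS.
  have sn : S + q ^+ n.+1 != 0.
    have -> : S + q ^+ n.+1 = S * (1 + q ^+ n.+1 / S) by field.
    by rewrite mulf_neq0.
  move: (qpoch _ _ _) => u1; move: (bqj_coef _ _) => u2.
  move: (1 - q ^+ n / q ^+ l) (1 - q ^+ n * q ^+ l.+1) => v4 v5.
  move: (q ^+ n.+1) sn (q ^+ k) => N sn K n1 n2 n3.
  by field; rewrite S0 sn n2 n3.
(* The right side has one more summand, k = l. Its coefficient vanishes for n < l, and [bqj_lam]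
   vanishes for n = l. *)
rewrite -mulr_sumr [in RHS]big_ord_recr /= mulrDr [X in _ = _ + X](_ : _ = 0) ?addr0 //.
move: nl; rewrite leq_eqVlt => /orP[/eqP ->|nl].
  by rewrite /bqj_lam divff ?expf_neq0 // subrr !(mulr0, mul0r).
rewrite (@bqj_coef0 n.+1 l) ?mul0r ?mulr0 // ltn_subrL; lia.
Qed.

Lemma bqj_backward n y : (n < l)%N ->
  (1 - q ^+ n.+1 * y) * (1 + q ^+ n.+1 * y / S) * bqj n.+1 y -
  (1 - y) * (1 + y / S) * bqj n.+1 (y / q) = bqj_mu n * y * bqj n y.
Proof.
move=> nl; rewrite /bqj !mulr_sumr -sumrB; apply/eqP; rewrite -subr_eq0 -sumrB; apply/eqP.
(* [g k] is minus the sum of the first k + 1 summands, in closed form. It vanishes at k = l because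
   l - (n + 1) < l. *)
pose g k := y * bqj_coef n.+1 k * qpoch (- (q ^+ n.+1 / S) * y) q k.+1 *
   (q ^+ n.+1 ^+ 2 * q ^+ k - 1) / (q ^+ n.+1 * q ^+ k).
pose h k := if k is j.+1 then g j else 0.
transitivity (\sum_(k < l.+1) (h k - h k.+1)); last first.
  rewrite -(big_mkord xpredT (fun k => h k - h k.+1)) -[LHS]opprK -sumrN.
  under eq_bigr do rewrite opprB.
  rewrite telescope_sumr //= /g bqj_coef0 //; last lia.
  by rewrite !(mulr0, mul0r) subrr oppr0.
apply: eq_bigr => -[k kl] _ /=.
(* All Pochhammer symbols are reduced to (- q^(n+1) y / S; q)_k; the factor 1 + q^(n+1) y / S
   supplies the missing first factor. *)
have e1 : - (q ^+ n.+2 / S) * y = - (q ^+ n.+1 / S) * y * q by rewrite [q ^+ n.+2]exprS; ring.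
have e2 : - (q ^+ n.+2 / S) * (y / q) = - (q ^+ n.+1 / S) * y.
  by rewrite [q ^+ n.+2]exprS; field; rewrite S0.
have e3 : (1 + q ^+ n.+1 * y / S) * qpoch (- (q ^+ n.+2 / S) * y) q k =
   qpoch (- (q ^+ n.+1 / S) * y) q k * (1 + q ^+ n.+1 / S * y * q ^+ k).
  transitivity (qpoch (- (q ^+ n.+1 / S) * y) q k.+1); last by rewrite qpochSr; ring.
  by rewrite qpochSl e1; ring.
have -> : (1 - q ^+ n.+1 * y) * (1 + q ^+ n.+1 * y / S) *
     (bqj_coef n.+1 k * qpoch (- (q ^+ n.+2 / S) * y) q k) =
  (1 - q ^+ n.+1 * y) * bqj_coef n.+1 k *
    ((1 + q ^+ n.+1 * y / S) * qpoch (- (q ^+ n.+2 / S) * y) q k) by ring.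
rewrite e3 e2.
case: k kl {e3} => [|k] kl.
  rewrite /h /g !qpochSr !qpoch0 /bqj_coef !qpoch0 /bqj_mu !expr0 !(mulr1, mul1r, invr1).
  have n0 : q ^+ n.+1 != 0 by rewrite expf_neq0.
  move: (q ^+ n.+1) n0 => N n0.
  by field; rewrite S0 n0.
rewrite /h /g.
have -> : bqj_coef n.+1 k.+1 = bqj_coef n.+1 k *
   (q * (1 - q ^+ n.+1 / q ^+ l * q ^+ k) * (1 - q ^+ n.+1 * q ^+ l.+1 * q ^+ k) /
    ((1 - q ^+ k.+1) * (1 - q ^+ n.+2 * q ^+ k) * (1 + q ^+ n.+2 / S * q ^+ k))).
  rewrite /bqj_coef !qpochSr mulNr opprK.
  have := qq k; have := qX n.+1 k; have := qA n.+1 k; have := q1 k.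
  have : 1 - q ^+ n.+2 * q ^+ k != 0 by rewrite -exprD; exact: q1.
  have : 1 + q ^+ n.+2 / S * q ^+ k != 0 by rewrite mulrAC -exprD.
  move: (qpoch _ _ _) => u1; move: (qpoch _ _ _) => u2; move: (qpoch _ _ _) => u3.
  move: (qpoch _ _ _) => u4; move: (qpoch _ _ _) => u5.
  rewrite ![q ^+ k.+1]exprS.
  move: (1 - q ^+ n.+2 * q ^+ k) (1 + q ^+ n.+2 / S * q ^+ k).
  move: (1 - _ * q ^+ k) (1 - _ * q ^+ k) => v4 v5.
  move: (q ^+ k) => K v1 v2 n1 n2 n3 n4 n5 n6.
  by field; do ?(apply/andP; split).
rewrite bqj_coefS !(@qpochSr _ _ _ k.+1) /bqj_mu.
have n0 : q ^+ n != 0 by rewrite expf_neq0.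
have k0 : q ^+ k != 0 by rewrite expf_neq0.
have l0 : q ^+ l != 0 by rewrite expf_neq0.
have m1 : 1 - q ^+ n.+2 * q ^+ k != 0 by rewrite -exprD; exact: q1.
have m2 : S + q ^+ n.+2 * q ^+ k != 0.
  have -> : S + q ^+ n.+2 * q ^+ k = S * (1 + q ^+ (n.+2 + k) / S) by rewrite exprD; field.
  by rewrite mulf_neq0.
have m3 : S + q ^+ n.+1 != 0.
  have -> : S + q ^+ n.+1 = S * (1 + q ^+ n.+1 / S) by field.
  by rewrite mulf_neq0.
have m4 := q1 n; have m5 := q1 k.
move: (qpoch _ _ _) (bqj_coef _ _) => u1 u2.
move: n0 k0 l0 m1 m2 m3 m4 m5; rewrite !exprS.
move: (q ^+ n) (q ^+ k) (q ^+ l) => N K L n0 k0 l0 m1 m2 m3 m4 m5.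
by field; do ?(apply/andP; split).
Qed.

(** At y = 1 the factor 1 - y removes one term of the backward relation. *)
Lemma bqj_at1 n : (n < l)%N -> bqj n 1 = - q ^+ n.+1 * bqj n.+1 1.
Proof.
move=> nl; have := bqj_backward 1 nl; rewrite subrr !mul0r subr0 !mulr1 /bqj_mu.
have := qS n.+1; have := q1 n; have : q ^+ n.+1 != 0 by rewrite expf_neq0.
move: (q ^+ n.+1) (bqj _ _) (bqj _ _) => N u v n0 n1 n2.
set w := 1 + _ in n2 *; clearbody w => h.
apply: (mulfI (mulf_neq0 n1 n2)).
transitivity (- N * ((1 - N^-1) * w * u)); first by field.
by rewrite -h; ring.
Qed.

Lemma bqj_mu_neq0 n : bqj_mu n != 0.
Proof.
rewrite mulf_neq0 //.
have -> : 1 - (q ^+ n.+1)^-1 = - (1 - q ^+ n.+1) / q ^+ n.+1.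
  by field; rewrite expf_neq0.
by rewrite mulf_neq0 ?oppr_eq0 ?invr_eq0 ?expf_neq0.
Qed.

Lemma bqj_lam_factor_neq0 n : (n < l)%N ->
  (1 - q ^+ n / q ^+ l) * (1 - q ^+ n * q ^+ l.+1) != 0.
Proof.
move=> nl.
rewrite mulf_neq0 //; last by rewrite -exprD addnS.
have -> : 1 - q ^+ n / q ^+ l = - (1 - q ^+ (l - n.+1).+1) / q ^+ (l - n.+1).+1.
  rewrite -{1}(subnKC nl) addSnnS exprD invfM mulrA divff ?expf_neq0 // mul1r.
  by field; rewrite expf_neq0.
by rewrite mulf_neq0 ?oppr_eq0 ?invr_eq0 ?expf_neq0.
Qed.

Lemma bqj_lam_mu n : bqj_lam n * bqj_mu n =
  - (q / S) * ((1 - q ^+ n / q ^+ l) * (1 - q ^+ n * q ^+ l.+1)).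
Proof.
rewrite /bqj_lam /bqj_mu.
have := qS n.+1; have := q1 n; have : q ^+ n.+1 != 0 by rewrite expf_neq0.
move: (1 - q ^+ n / q ^+ l) (1 - q ^+ n * q ^+ l.+1) => v1 v2.
move: (1 + q ^+ n.+1 / S) => w.
move: (q ^+ n.+1) => N n0 n1 n2.
by field; do ?(apply/andP; split).
Qed.
End BigQJacobi.

(* [V] is arbitrary when n + 1 = l: its coefficient [bqj_lam] vanishes there. *)
Lemma bqj_three_term (F : fieldType) (q S : F) l n y V :
  q != 0 -> (forall k, 1 - q ^+ k.+1 != 0) -> S != 0 -> (forall k, 1 + q ^+ k / S != 0) ->
  (n < l)%N -> y != 0 ->
  ((n.+1 < l)%N -> V = (1 - q ^+ n.+2 * y) * (1 + q ^+ n.+2 * y / S) * bqj q S l n.+2 y) ->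
  bqj q S l n y =
  ((((1 - q ^+ n.+1 * y) * (1 + q ^+ n.+1 * y / S) - (1 - y) * (1 + y / S)) / y
    + bqj_lam q S l n.+1 * bqj_mu q S n.+1 * y / q) * bqj q S l n.+1 y
   - bqj_lam q S l n.+1 / q * V) / bqj_mu q S n.
Proof.
move=> q0 q1 S0 qS nl y0 hV.
have mu0 : bqj_mu q S n != 0 by exact: bqj_mu_neq0.
have back := bqj_backward q0 q1 S0 qS y nl.
have forw := bqj_forward q0 q1 S0 qS (y / q) nl.
rewrite [q * (y / q)]mulrC divfK // in forw.
(* The forward relation at y / q introduces [bqj n.+2] at y / q, and the backward relation for n + 1
   brings it back to y. The factor [bqj_lam] makes the equation hold for n + 1 = l too. *)
have key : (1 - y) * (1 + y / S) * (bqj_lam q S l n.+1 * bqj q S l n.+2 (y / q)) =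
    bqj_lam q S l n.+1 * (V - bqj_mu q S n.+1 * y * bqj q S l n.+1 y).
  move: nl; rewrite leq_eqVlt => /orP[/eqP nl|nl].
    suff -> : bqj_lam q S l n.+1 = 0 by rewrite !mul0r mulr0.
    by rewrite /bqj_lam nl divff ?expf_neq0 // subrr !(mulr0, mul0r).
  by rewrite hV // -(bqj_backward q0 q1 S0 qS y nl); ring.
move: key back forw.
move: (bqj q S l n.+2 _) (bqj q S l n.+1 (y / q)) (bqj q S l n.+1 y) (bqj q S l n y) => v u2 u a.
move: (bqj_lam _ _ _ _) (bqj_mu _ _ n.+1) mu0 => la m mu0.
move: (bqj_mu _ _ _) mu0 => m0 m00 key back forw.
have e2 : u2 = u + la * (y / q) * v by rewrite -forw; ring.
apply: (mulfI (mulf_neq0 m00 y0)); rewrite -back e2.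
rewrite (_ : _ * (u + _) = (1 - y) * (1 + y / S) * u + y / q * ((1 - y) * (1 + y / S) * (la * v)));
  last by ring.
rewrite key.
by field; rewrite y0 S0 m00 q0.
Qed.

(** * The commutation relation above the diagonal *)

(* With Z = q^n, L = q^l and y = q^m, [U] and [W] stand for the polynomial of degree l - n and
   a multiple of the one of degree l - n - 1, in the variable y; [U'] and [W'] for those in the
   variable P y. *)
Lemma commutation_identity (F : fieldType)
    (r s t Z L y P U U' W W' D1 q S T La0 La m m' m0 m0' : F) :
  q = r ^+ 2 -> S = s ^+ 2 -> T = t ^+ 2 ->
  La0 = (1 - Z / q / L) * (1 - Z * L) -> La = (1 - Z / L) * (1 - Z * (q * L)) ->
  m = (1 - (q * Z)^-1) * (1 + q * Z / S) -> m' = (1 - (q * Z)^-1) * (1 + q * Z / T) ->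
  m0 = (1 - Z^-1) * (1 + Z / S) -> m0' = (1 - Z^-1) * (1 + Z / T) ->
  y != 0 -> P != 0 -> r != 0 -> s != 0 -> t != 0 -> Z != 0 -> L != 0 ->
  La0 != 0 -> m != 0 -> m' != 0 -> m0 != 0 -> m0' != 0 ->
  let E S y := ((1 - Z * y) * (1 + Z * y / S) - (1 - y) * (1 + y / S)) / y
               - q / S * La * y / q in
  let a := (E S y * U - - (q / S) * La / m / q * W) / m0 in
  let a' := (E T (P * y) * U' - - (q / T) * La / m' / q * W') / m0' in
  let B Q := r / (s * t) * Q * (P * S + T - 1 - P * (1 - (1 + q) * Q)) in
  - D1 * (s * t * r) * m0 * m0' / (q * La0) *
    (a * a' - (a - - (q / S) * La0 / m0 * y * U) * (a' - - (q / T) * La0 / m0' * (P * y) * U')) +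
  (B (Z * y) - B y) * (D1 * U * U') +
  - q * La * D1 / (s * t * r * m * m') *
    (W * W' - (W - m * y * U) * (W' - m' * (P * y) * U')) = 0.
Proof.
move=> -> -> -> -> -> -> -> -> -> y0 P0 r0 s0 t0 Z0 L0.
have r20 : r ^+ 2 != 0 by rewrite expf_neq0.
have s20 : s ^+ 2 != 0 by rewrite expf_neq0.
have t20 : t ^+ 2 != 0 by rewrite expf_neq0.
rewrite !mulf_eq0 !negb_or => /andP[a1 a2] /andP[a3 a4] /andP[_ a5] /andP[a6 a7] /andP[_ a8].
(* The denominators as [field] meets them: each is a nonzero monomial times a factor of [La0], [m],
   [m'], [m0] or [m0']. *)
have b1 : r ^+ 2 * L - Z != 0.
  have -> : r ^+ 2 * L - Z = r ^+ 2 * L * (1 - Z / r ^+ 2 / L) by field; do ?(apply/andP; split).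
  by rewrite !mulf_neq0.
have b2 : s ^+ 2 + Z != 0.
  have -> : s ^+ 2 + Z = s ^+ 2 * (1 + Z / s ^+ 2) by field; do ?(apply/andP; split).
  by rewrite mulf_neq0.
have b3 : t ^+ 2 + Z != 0.
  have -> : t ^+ 2 + Z = t ^+ 2 * (1 + Z / t ^+ 2) by field; do ?(apply/andP; split).
  by rewrite mulf_neq0.
have b4 : s ^+ 2 + r ^+ 2 * Z != 0.
  have -> : s ^+ 2 + r ^+ 2 * Z = s ^+ 2 * (1 + r ^+ 2 * Z / s ^+ 2)
    by field; do ?(apply/andP; split).
  by rewrite mulf_neq0.
have b5 : t ^+ 2 + r ^+ 2 * Z != 0.
  have -> : t ^+ 2 + r ^+ 2 * Z = t ^+ 2 * (1 + r ^+ 2 * Z / t ^+ 2)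
    by field; do ?(apply/andP; split).
  by rewrite mulf_neq0.
have b6 : Z - 1 != 0.
  have -> : Z - 1 = Z * (1 - Z^-1) by field.
  by rewrite mulf_neq0.
have b7 : r ^+ 2 * Z - 1 != 0.
  have -> : r ^+ 2 * Z - 1 = r ^+ 2 * Z * (1 - (r ^+ 2 * Z)^-1) by field; do ?(apply/andP; split).
  by rewrite !mulf_neq0.
move=> /=.
by field; do ?(apply/andP; split).
Qed.

Section Commutation.
Variables (F : fieldType) (q S T r s t P : F) (l : nat) (D : nat -> F).
Hypothesis qE : q = r ^+ 2.
Hypothesis SE : S = s ^+ 2.
Hypothesis TE : T = t ^+ 2.
Hypothesis r0 : r != 0.
Hypothesis s0 : s != 0.
Hypothesis t0 : t != 0.
Hypothesis P0 : P != 0.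
Hypothesis q1 : forall k, 1 - q ^+ k.+1 != 0.
Hypothesis qS : forall k, 1 + q ^+ k / S != 0.
Hypothesis qT : forall k, 1 + q ^+ k / T != 0.
Hypothesis D0 : forall n, (l < n)%N -> D n = 0.
Hypothesis DS : forall n, D n.+1 * (s * t * r) * bqj_mu q S n * bqj_mu q T n =
   - q * ((1 - q ^+ n / q ^+ l) * (1 - q ^+ n * q ^+ l.+1)) * D n.

Let q0 : q != 0. Proof. by rewrite qE expf_neq0. Qed.
Let S0 : S != 0. Proof. by rewrite SE expf_neq0. Qed.
Let T0 : T != 0. Proof. by rewrite TE expf_neq0. Qed.

(** With y = q^m, [lin_coef n] will be the coefficient of the q-Laguerre polynomial of degree m + n,
    while [lag_diag] and [lag_down] are the coefficients of the q-Laguerre recurrence in degree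
    m. *)
Definition lin_coef n y := D n * bqj q S l n y * bqj q T l n (P * y).

Definition lag_diag y := r / (s * t) * y * (P * S + T - 1 - P * (1 - (1 + q) * y)).

Definition lag_down y := (1 - y) * (1 - P * y) * (1 + P * y / T) * (1 + y / S).

(** For y = q^m this is the entry (m, m + n + 1) of the commutation relation. *)
Lemma lin_coef_commutation n y : y != 0 ->
  lin_coef n y - lin_coef n (q * y) +
  (lag_diag (q ^+ n.+1 * y) - lag_diag y) * lin_coef n.+1 y +
  lag_down (q ^+ n.+2 * y) * lin_coef n.+2 y - lag_down y * lin_coef n.+2 (y / q) = 0.
Proof.
move=> y0.
(* For n >= l only the first two terms can be nonzero, and they cancel: [D n] is 0, or n = l and
   both polynomials are the constant 1. *)
case: (ltnP n l) => [nl|ln]; last first.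
  have d1 : D n.+1 = 0 by apply: D0; lia.
  have d2 : D n.+2 = 0 by apply: D0; lia.
  rewrite /lin_coef d1 d2; move: ln; rewrite leq_eqVlt => /orP[/eqP <-|/D0 ->]; last by ring.
  by rewrite !bqj_l //; ring.
have Py0 : P * y != 0 by rewrite mulf_neq0.
have La0 : (1 - q ^+ n / q ^+ l) * (1 - q ^+ n * q ^+ l.+1) != 0 by exact: bqj_lam_factor_neq0.
have muS k : bqj_mu q S k != 0 by exact: bqj_mu_neq0.
have muT k : bqj_mu q T k != 0 by exact: bqj_mu_neq0.
(* [V S y] and [V S y] minus [bqj_mu q S n.+1 * y * bqj q S l n.+1 y] are the two terms of the
   backward relation for n + 1. When n + 1 = l, the coefficients [D n.+2] and [bqj_lam n.+1] in
   front of them vanish. *)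
pose V S y := if (n.+1 < l)%N then (1 - q ^+ n.+2 * y) * (1 + q ^+ n.+2 * y / S) * bqj q S l n.+2 y
  else bqj_mu q S n.+1 * y * bqj q S l n.+1 y.
have hV S' y' : (n.+1 < l)%N ->
    V S' y' = (1 - q ^+ n.+2 * y') * (1 + q ^+ n.+2 * y' / S') * bqj q S' l n.+2 y'.
  by rewrite /V => ->.
have lamS k : bqj_lam q S l k =
   - (q / S) * ((1 - q ^+ k / q ^+ l) * (1 - q ^+ k * q ^+ l.+1)) / bqj_mu q S k.
  by rewrite -bqj_lam_mu // mulfK.
have lamT k : bqj_lam q T l k =
   - (q / T) * ((1 - q ^+ k / q ^+ l) * (1 - q ^+ k * q ^+ l.+1)) / bqj_mu q T k.
  by rewrite -bqj_lam_mu // mulfK.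
have fS : bqj q S l n (q * y) = bqj q S l n y - bqj_lam q S l n * y * bqj q S l n.+1 y.
  by rewrite -(bqj_forward q0 q1 S0 qS _ (ltnW nl)); ring.
have fT : bqj q T l n (P * (q * y)) =
    bqj q T l n (P * y) - bqj_lam q T l n * (P * y) * bqj q T l n.+1 (P * y).
  by rewrite -(bqj_forward q0 q1 T0 qT _ (ltnW nl)) mulrCA; ring.
have aS := bqj_three_term q0 q1 S0 qS nl y0 (@hV S y).
have aT := bqj_three_term q0 q1 T0 qT nl Py0 (@hV T (P * y)).
have Dn : D n = - D n.+1 * (s * t * r) * bqj_mu q S n * bqj_mu q T n /
   (q * ((1 - q ^+ n / q ^+ l) * (1 - q ^+ n * q ^+ l.+1))).
  rewrite !mulNr DS !mulNr opprK [_ * D n]mulrC mulfK // mulf_neq0 //.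
have Dn2 : D n.+2 = - q * ((1 - q ^+ n.+1 / q ^+ l) * (1 - q ^+ n.+1 * q ^+ l.+1)) * D n.+1 /
   (s * t * r * bqj_mu q S n.+1 * bqj_mu q T n.+1).
  rewrite -DS; move: (muS n.+1) (muT n.+1); move: (bqj_mu _ _ _) (bqj_mu _ _ _) => m m' m0 m'0.
  by field; do ?(apply/andP; split).
have W2 : lag_down (q ^+ n.+2 * y) * lin_coef n.+2 y - lag_down y * lin_coef n.+2 (y / q) =
  D n.+2 * (V S y * V T (P * y) - (V S y - bqj_mu q S n.+1 * y * bqj q S l n.+1 y) *
    (V T (P * y) - bqj_mu q T n.+1 * (P * y) * bqj q T l n.+1 (P * y))).
  rewrite /lin_coef /lag_down.
  move: nl; rewrite leq_eqVlt => /orP[/eqP nl|nl]; first by rewrite D0 ?nl //; ring.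
  rewrite /V nl -(bqj_backward q0 q1 S0 qS y nl) -(bqj_backward q0 q1 T0 qT (P * y) nl).
  rewrite (mulrA P y q^-1); ring.
rewrite -addrA W2 /lin_coef fS fT Dn2 Dn aS aT.
have := @commutation_identity F r s t (q ^+ n.+1) (q ^+ l) y P (bqj q S l n.+1 y)
 (bqj q T l n.+1 (P * y)) (V S y) (V T (P * y)) (D n.+1) q S T
 ((1 - q ^+ n / q ^+ l) * (1 - q ^+ n * q ^+ l.+1))
 ((1 - q ^+ n.+1 / q ^+ l) * (1 - q ^+ n.+1 * q ^+ l.+1))
 (bqj_mu q S n.+1) (bqj_mu q T n.+1) (bqj_mu q S n) (bqj_mu q T n) qE SE TE.
have n0 : q ^+ n.+1 != 0 by rewrite expf_neq0.
have l0 : q ^+ l != 0 by rewrite expf_neq0.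
have e1 : q ^+ n.+1 / q = q ^+ n by rewrite exprSr mulfK.
have e2 : q ^+ n.+1 * q ^+ l = q ^+ n * q ^+ l.+1 by rewrite -!exprD addnS.
rewrite e1 e2 -!exprS => /(_ erefl erefl erefl erefl erefl erefl).
move=> /(_ y0 P0 r0 s0 t0 n0 l0 La0 (muS _) (muT _) (muS _) (muT _)).
rewrite !bqj_lam_mu // !lamS !lamT /= => h.
rewrite -[RHS]h /lag_diag.
ring.
Qed.

End Commutation.

(** * Linearization from a commuting symmetric matrix *)

Section SymmetricOperator.
Variables (F : fieldType) (X f : F) (L : nat) (v B C : nat -> F) (G : nat -> nat -> F).
Hypothesis v0 : X * v 0%N = v 1%N + B 0%N * v 0%N.
Hypothesis vS : forall k, X * v k.+1 = v k.+2 + B k.+1 * v k.+1 + C k.+1 * v k.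
Hypothesis C0 : C 0%N = 0.
Hypothesis CS : forall k, C k.+1 != 0.
Hypothesis G0 : forall n m, (L < n)%N -> G n m = 0.
Hypothesis GC : forall n m,
  G n m - G n m.+1 + (B (m + n.+1) - B m) * G n.+1 m + C (m + n.+2) * G n.+2 m
  - C m * G n.+2 m.-1 = 0.
Hypothesis fv0 : f * v 0%N = \sum_(k < L.+1) G k 0%N * v k.

(** The squared norms of orthogonal polynomials with this recurrence: rescaling by them makes the
    tridiagonal matrix symmetric. *)
Let h m := \prod_(i < m) C i.+1.

Let h0 m : h m != 0.
Proof. by apply/prodf_neq0 => i _. Qed.

Let hS m : h m.+1 = h m * C m.+1.
Proof. by rewrite /h big_ord_recr. Qed.

(* The matrix of multiplication by [f] in the basis [v], rescaled to be symmetric. *)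
Let K m k := if (m <= k)%N then G (k - m) m / h m else G (m - k) k / h k.

Let K_sym m k : K m k = K k m.
Proof.
rewrite /K; case: (ltngtP m k) => // ->; by rewrite subnn.
Qed.

Let K_far m k : (m + L < k)%N -> K m k = 0.
Proof.
by move=> mk; rewrite /K ifT ?G0 ?mul0r //; lia.
Qed.

Let K_add m n : K m (m + n) = G n m / h m.
Proof. by rewrite /K leq_addr addKn. Qed.

(** The action of X on coordinates: the coefficient of [v k] in X times the sum of the
    [g j * v j]. *)
Let shift (g : nat -> F) k :=
  (if k is j.+1 then g j else 0) + B k * g k + C k.+1 * g k.+1.

Let shiftS g k : shift g k.+1 = g k + B k.+1 * g k.+1 + C k.+2 * g k.+2.
Proof. by []. Qed.

(** As K is symmetric, the two sides are the entries (m, k) of the products of K and the tridiagonal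
    matrix in either order. Transposition exchanges them, so m < k may be assumed; for k = m + n + 1
    the equation is [GC] divided by [h m]. *)
Let K_commute m k : shift (K m) k = shift (K k) m.
Proof.
wlog mk : m k / (m < k)%N.
  by move=> W; case: (ltngtP m k) => [| |-> //]; [exact: W | move=> /W].
have -> : k = (m + (k - m).-1.+1)%N by lia.
move: (k - m).-1 => n {k mk}.
have e : K (m + n.+1) m.+1 = G n m.+1 / h m.+1 by rewrite K_sym addnS -addSn K_add.
have e1 : C m.+1 * (G n m.+1 / h m.+1) = G n m.+1 / h m.
  by rewrite hS; field; rewrite CS h0.
rewrite [in LHS]addnS shiftS -!addnS !K_add.
(* For m = 0 the term of [GC] with the truncated index [m.-1] has the factor [C 0], which is 0. *)
have := GC n m; case: m e e1 => [|m] e e1 gc.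
  rewrite /shift e e1 K_sym K_add.
  transitivity ((G n 0%N + B (0 + n.+1)%N * G n.+1 0%N + C (0 + n.+2)%N * G n.+2 0%N) / h 0).
    by ring.
  transitivity ((B 0%N * G n.+1 0%N + G n 1%N) / h 0); last by ring.
  by congr (_ / _); apply/eqP; rewrite -subr_eq0 -gc C0; apply/eqP; ring.
have e2 : K m (m.+1 + n.+1) = G n.+2 m / h m by rewrite addSnnS K_add.
rewrite shiftS e e1 [K (_ + _) m.+1]K_sym K_add [K _ m]K_sym e2.
have -> : G n.+2 m / h m = C m.+1 * G n.+2 m / h m.+1 by rewrite hS; field; rewrite CS h0.
transitivity ((G n m.+1 + B (m.+1 + n.+1)%N * G n.+1 m.+1 + C (m.+1 + n.+2)%N * G n.+2 m.+1)
  / h m.+1).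
  by ring.
transitivity ((C m.+1 * G n.+2 m + B m.+1 * G n.+1 m.+1 + G n m.+2) / h m.+1); last by ring.
by congr (_ / _); apply/eqP; rewrite -subr_eq0 -gc; apply/eqP; ring.
Qed.

(** The last two terms are the boundary terms at the cutoff N. *)
Let sum_shift (g : nat -> F) N :
  \sum_(k < N.+1) g k * (X * v k) =
  \sum_(k < N.+1) shift g k * v k + g N * v N.+1 - C N.+1 * g N.+1 * v N.
Proof.
elim: N => [|N IH]; first by rewrite !big_ord1 /= v0 /shift; ring.
by rewrite big_ord_recr /= IH [in RHS]big_ord_recr /= vS /shift; ring.
Qed.

(** Beyond the band of K the boundary terms vanish, and commutation moves the shift from the column
    index to the row index, where it is a recurrence between rows. *)
Let sum_commute m N : (m + L < N)%N ->
  X * \sum_(k < N.+1) K m k * v k = \sum_(k < N.+1) shift (K ^~ k) m * v k.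
Proof.
move=> mN; rewrite mulr_sumr.
under eq_bigr do rewrite mulrCA.
rewrite sum_shift !K_far; [|lia..].
rewrite mulr0 !mul0r subr0 addr0; apply: eq_bigr => k _; rewrite K_commute.
by congr (_ * _); rewrite /shift; case: m mN => [|m] _; rewrite ![K k _]K_sym.
Qed.

(** Both sides satisfy the same three-term recurrence in m and agree at m = 0; the induction carries
    two consecutive rows. *)
Let mul_v m N : (m + L <= N)%N -> f * v m = h m * \sum_(k < N.+1) K m k * v k.
Proof.
have K0 k : K 0 k = G k 0%N by rewrite /K subn0 /h big_ord0 divr1.
have base N' : (L <= N')%N -> f * v 0%N = \sum_(k < N'.+1) K 0 k * v k.
  move=> LN; rewrite fv0 (big_ord_widen N'.+1 (fun k => G k 0%N * v k)) //.
  rewrite big_mkcond /=; apply: eq_bigr => k _; rewrite K0; case: ltnP => // Lk.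
  by rewrite G0 ?mul0r.
suff W : forall m N, (m.+1 + L <= N)%N ->
    f * v m = h m * (\sum_(k < N.+1) K m k * v k) /\
    f * v m.+1 = h m.+1 * (\sum_(k < N.+1) K m.+1 k * v k).
  case: m => [|m] mN; last by case: (W m N mN).
  by rewrite /h big_ord0 mul1r; apply: base; lia.
elim=> [|{}m IH] {}N mN.
  have b : f * v 0%N = \sum_(k < N.+1) K 0 k * v k by apply: base; lia.
  split; first by rewrite /h big_ord0 mul1r.
  have H : X * _ = _ := @sum_commute 0 N mN.
  rewrite /shift in H.
  transitivity (f * (X * v 0%N - B 0%N * v 0%N)); first by rewrite v0; ring.
  rewrite mulrBr mulrCA [f * (B _ * _)]mulrCA !b H hS {1}/h big_ord0 mul1r.
  rewrite !mulr_sumr -sumrB; apply: eq_bigr => k _; ring.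
have [IH1 IH2] : f * v m = h m * (\sum_(k < N.+1) K m k * v k) /\
    f * v m.+1 = h m.+1 * (\sum_(k < N.+1) K m.+1 k * v k) by apply: IH; lia.
split=> //.
have H := @sum_commute m.+1 N mN; rewrite /shift in H.
transitivity (f * (X * v m.+1 - B m.+1 * v m.+1 - C m.+1 * v m)); first by rewrite vS; ring.
transitivity (X * (f * v m.+1) - B m.+1 * (f * v m.+1) - C m.+1 * (f * v m)); first by ring.
rewrite IH1 IH2 [X * _]mulrCA H !hS.
rewrite !mulr_sumr -!sumrB; apply: eq_bigr => k _; ring.
Qed.

Lemma linearization_of_commuting m :
  f * v m = \sum_(0 <= n < L.+1) G n m * v (m + n)%N +
   \sum_(1 <= n < L.+1 | (n <= m)%N) (\prod_(i < n) C (m - i)%N) * G n (m - n)%N * v (m - n)%N.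
Proof.
rewrite (@mul_v m (m + L)) // -addnS -(big_mkord xpredT (fun k => K m k * v k)).
rewrite mulr_sumr (@big_cat_nat _ _ _ m) //=; last by rewrite leq_addr.
rewrite addrC; congr (_ + _).
  rewrite -{1}[m]addn0 [in X in \sum_(X <= _ < _) _]addnC big_addn addKn !big_mkord.
  apply: eq_bigr => n _; by rewrite [(n + m)%N]addnC K_add; field.
(* Below the diagonal the rescaling leaves the ratio of [h m] to [h (m - n)], which is the product
   in the second sum. *)
have h_prod n : (n <= m)%N -> h m = h (m - n) * \prod_(i < n) C (m - i)%N.
  elim: n => [|n IH] nm; first by rewrite big_ord0 mulr1 subn0.
  rewrite IH ?(ltnW nm) // big_ord_recr /= -[in LHS](subnSK nm) hS subnSK //; ring.
have K_sub n : (n <= m)%N -> h m * (K m (m - n) * v (m - n)%N) =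
    (\prod_(i < n) C (m - i)%N) * G n (m - n)%N * v (m - n)%N.
  move=> nm; have e : K m (m - n) = G n (m - n)%N / h (m - n) by rewrite K_sym -K_add subnK.
  by rewrite e (h_prod n nm); field.
rewrite big_nat_rev /= add0n.
transitivity (\sum_(1 <= n < m.+1) h m * (K m (m - n) * v (m - n)%N)).
  by rewrite big_add1.
(* The two sums range over n <= m and over n <= min(m, L); they are compared on n <= m + L, where
   [G n] vanishes for n > L. *)
rewrite [LHS](big_nat_widen _ _ (m + L).+1) ?ltnS ?leq_addr //.
rewrite [RHS](big_nat_widen _ _ (m + L).+1) ?ltnS ?leq_addl //.
rewrite [LHS]big_mkcond [RHS]big_mkcond /=; apply: eq_big_nat => n _.
rewrite !ltnS; case: (leqP n m) => nm //=; case: (leqP n L) => nL; rewrite K_sub //.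
by rewrite G0 // mulr0 mul0r.
Qed.
End SymmetricOperator.

(** * q-Legendre times q-Laguerre *)

(* S = q^(2 tau), T = q^(2 sigma), P = q^p, r = q^(1/2), s = q^tau, t = q^sigma. *)
Section Linearization.
Variables (F : fieldType) (q S T r s t P z : F) (l : nat).
Hypothesis qE : q = r ^+ 2.
Hypothesis SE : S = s ^+ 2.
Hypothesis TE : T = t ^+ 2.
Hypothesis r0 : r != 0.
Hypothesis s0 : s != 0.
Hypothesis t0 : t != 0.
Hypothesis P0 : P != 0.
Hypothesis z0 : z != 0.
Hypothesis q1 : forall k, 1 - q ^+ k.+1 != 0.
Hypothesis qS : forall k, 1 + q ^+ k / S != 0.
Hypothesis qT : forall k, 1 + q ^+ k / T != 0.
Hypothesis qSV : forall k, 1 + q ^+ k * S != 0.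
Hypothesis qP : forall k, 1 - P * q ^+ k.+1 != 0.
Hypothesis qPT : forall k, 1 + P * q ^+ k / T != 0.

Let q0 : q != 0. Proof. by rewrite qE expf_neq0. Qed.
Let S0 : S != 0. Proof. by rewrite SE expf_neq0. Qed.
Let T0 : T != 0. Proof. by rewrite TE expf_neq0. Qed.

Let qq k : qpoch q q k != 0.
Proof. by apply: qpoch_neq0 => i _; rewrite -exprS. Qed.

(** D^(n,l), with q^((l-n)^2 / 2) written as a power of r = q^(1/2), and extended by 0 so that
    [lin_constS] holds for every n. *)
Definition lin_const n : F :=
  if (n <= l)%N then
    qpoch (- (T / q ^+ l)) q (l - n) * qpoch (- (S / q ^+ l)) q (l - n) *
    (qpoch (q ^+ (l - n).+1) q n / qpoch q q n) * qpoch (q ^+ n.+1) q l *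
    (r ^+ ((l - n) ^ 2) / (s * t) ^+ (l - n))
  else 0.

Lemma lin_constS n : lin_const n.+1 * (s * t * r) * bqj_mu q S n * bqj_mu q T n =
   - q * ((1 - q ^+ n / q ^+ l) * (1 - q ^+ n * q ^+ l.+1)) * lin_const n.
Proof.
rewrite /lin_const; case: (ltngtP n l) => [nl|nl|->].
- have -> : (l - n = (l - n.+1).+1)%N by lia.
  have lE : (l = (l - n.+1) + n.+1)%N by lia.
  have e1 : qpoch (q ^+ n.+2) q l = qpoch (q ^+ n.+1) q l * (1 - q ^+ n.+1 * q ^+ l)
      / (1 - q ^+ n.+1).
    by rewrite -qpochSr qpochSl -exprSr; field; exact: q1.
  rewrite e1; move: (qpoch _ q l) => u1.
  move: (l - n.+1)%N lE => N lE {e1}.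
  have -> : qpoch (q ^+ N.+1) q n.+1 = (1 - q ^+ N.+1) * qpoch (q ^+ N.+2) q n.
    by rewrite qpochSl -exprSr.
  have ql : q ^+ l = q ^+ N * q ^+ n.+1 by rewrite {1}lE exprD.
  rewrite !qpochSr /bqj_mu.
  move: (qpoch _ q N) => u2; move: (qpoch _ q N) => u3; move: (qpoch (q ^+ N.+2) q n) => u4.
  move: (qq n); move: (qpoch q q n) => u5 u50.
  have -> : r ^+ (N.+1 ^ 2) = r ^+ (N ^ 2) * (q ^+ N * r).
    rewrite qE -exprM -exprSr -exprD; congr (_ ^+ _); lia.
  move: (r ^+ (N ^ 2)) => u6.
  rewrite [(s * t) ^+ N.+1]exprS.
  have : (s * t) ^+ N != 0 by rewrite expf_neq0 ?mulf_neq0.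
  move: ((s * t) ^+ N) => u7 u70.
  have n1 := q1 n; have n2 := q1 N.
  rewrite [q ^+ l.+1]exprS !ql.
  have K0 : q ^+ N != 0 by rewrite expf_neq0.
  have Z0 : q ^+ n != 0 by rewrite expf_neq0.
  move: n1 n2; rewrite !exprS; move: (q ^+ N) (q ^+ n) K0 Z0 => K Z K0 Z0 n1 n2.
  by rewrite SE TE; field; do ?(apply/andP; split).
- by rewrite mulr0 !mul0r.
- by rewrite divff ?expf_neq0 // subrr !(mul0r, mulr0).
Qed.

(** These are the q-Legendre parameters; replacing a by P a and d by 0 gives the q-Laguerre ones.
    Both families keep b and c. *)
Let a := r * s / t.
Let b := r * t / s.
Let c := - (r / (s * t)).
Let d := - (s * t * r).

Let lag := aw_poly q z (P * a) b c 0.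
Let leg := aw_poly q z a b c d.

Let abE : a * b = q. Proof. by rewrite /a /b qE; field; do ?(apply/andP; split). Qed.
Let acE : a * c = - (q / T). Proof. by rewrite /a /c qE TE; field; do ?(apply/andP; split). Qed.
Let adE : a * d = - (q * S). Proof. by rewrite /a /d qE SE; field; do ?(apply/andP; split). Qed.
Let cbE : c * b = - (q / S). Proof. by rewrite /c /b qE SE; field; do ?(apply/andP; split). Qed.
Let cdE : c * d = q. Proof. by rewrite /c /d qE; field; do ?(apply/andP; split). Qed.
Let a0 : a != 0. Proof. by rewrite !mulf_neq0 ?invr_eq0. Qed.
Let c0 : c != 0. Proof. by rewrite oppr_eq0 !mulf_neq0 ?invr_eq0 ?mulf_neq0. Qed.

Let qn1 k : 1 - q * q ^+ k != 0. Proof. by rewrite -exprS. Qed.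
Let ac1 k : 1 - a * c * q ^+ k != 0.
Proof. by rewrite acE mulNr opprK mulrAC -exprS. Qed.
Let cb1 k : 1 - c * b * q ^+ k != 0.
Proof. by rewrite cbE mulNr opprK mulrAC -exprS. Qed.
Let ad1 k : 1 - a * d * q ^+ k != 0.
Proof. by rewrite adE mulNr opprK mulrAC -exprS. Qed.
Let Pab1 k : 1 - P * a * b * q ^+ k != 0.
Proof. by rewrite -[P * a * b]mulrA abE -mulrA -exprS. Qed.
Let Pac1 k : 1 - P * a * c * q ^+ k != 0.
Proof.
rewrite -[P * a * c]mulrA acE (_ : 1 - _ = 1 + P * q ^+ k.+1 / T) //.
by rewrite exprS; ring.
Qed.
Let zero1 x k : 1 - x * 0 * q ^+ k != 0.
Proof. by rewrite mulr0 mul0r subr0 oner_eq0. Qed.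
Let zero2 x k : 1 - x * 0 / q * q ^+ k != 0.
Proof. by rewrite mulr0 !mul0r subr0 oner_eq0. Qed.

(** With c in first place, both families are expanded in the same [aw_basis z c q]. *)
Lemma lag_swap n : lag n = aw_poly q z c b (P * a) 0 n.
Proof.
by apply: aw_poly_swap => //; exact: mulf_neq0.
Qed.

Lemma leg_swap n : leg n = aw_poly q z c b a d n.
Proof.
apply: aw_poly_swap => //; first by move=> k; rewrite abE.
- by move=> k; rewrite cdE.
- by move=> k; rewrite abE -[q * c * d]mulrA cdE mulfK.
Qed.

Let up1 Q : aw_up q (P * a) b c 0 Q = 1.
Proof. by rewrite /aw_up mulr0 !mul0r !subr0 mulr1 divr1. Qed.

Let diagE Q : aw_diag q (P * a) b c 0 Q = lag_diag q S T r s t P Q.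
Proof.
rewrite /aw_diag up1 /aw_low /lag_diag !(mulr0, mul0r, subr0, divr1, mulr1).
rewrite /a /b /c SE TE qE.
by field; do ?(apply/andP; split).
Qed.

Let downE Q : aw_down q (P * a) b c 0 Q = lag_down S T P Q.
Proof.
rewrite /aw_down /lag_down !(mulr0, mul0r, subr0, divr1, mulr1).
rewrite /a /b /c SE TE qE.
by field; do ?(apply/andP; split).
Qed.

Lemma lag_rec0 : (z + z^-1) * lag 0 = lag 1 + lag_diag q S T r s t P 1 * lag 0.
Proof.
by rewrite /lag aw_poly_rec0 ?up1 ?diagE ?mul1r //; exact: mulf_neq0.
Qed.

Lemma lag_recS n : (z + z^-1) * lag n.+1 = lag n.+2 +
  lag_diag q S T r s t P (q ^+ n.+1) * lag n.+1 + lag_down S T P (q ^+ n.+1) * lag n.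
Proof.
by rewrite /lag aw_poly_recS ?up1 ?diagE ?downE ?mul1r //; exact: mulf_neq0.
Qed.

(** * The connection formula *)

(* (-1)^n q^(n(n-1)/2) *)
Let kappa n := \prod_(i < n) - q ^+ i.

Let kappaS n : kappa n.+1 = - q ^+ n * kappa n.
Proof. by rewrite /kappa big_ord_recr mulrC. Qed.

(** Reversal of a Pochhammer symbol: 1 - q^(-i) = - q^(-i) (1 - q^i) in each factor. *)
Lemma qpochV_kappa n j :
  qpoch (q ^- (n + j)) q n * q ^+ (n + j) ^+ n * qpoch q q j = kappa n * qpoch q q (n + j).
Proof.
elim: n => [|n IH]; first by rewrite /kappa big_ord0 qpoch0 expr0 add0n !mul1r.
rewrite kappaS addSn qpochSl.
have -> : q ^- (n + j).+1 * q = q ^- (n + j) by rewrite exprS; field; rewrite expf_neq0 // q0.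
rewrite [in RHS]qpochSr -exprS.
transitivity (- q ^+ n * (1 - q ^+ (n + j).+1) * (kappa n * qpoch q q (n + j))); last by ring.
rewrite -IH.
have -> : q ^+ (n + j).+1 ^+ n.+1 = q ^+ (n + j).+1 * (q ^+ n * q ^+ (n + j) ^+ n).
  by rewrite exprS [q ^+ _.+1 in X in _ * X]exprS exprMn.
have : q ^+ (n + j).+1 != 0 by rewrite expf_neq0.
move: (q ^+ (n + j) ^+ n) => u; move: (q ^+ (n + j).+1) => v v0.
move: (qpoch (_ ^-1) _ _) => w.
by field.
Qed.

Lemma kappa_sqr n : kappa n ^+ 2 * q ^+ n = q ^+ (n * n).
Proof.
elim: n => [|n IH]; first by rewrite /kappa big_ord0 expr1n mulr1 muln0.
rewrite kappaS mulSn mulnS !exprD -IH [q ^+ n.+1]exprS; ring.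
Qed.

(* The coefficient of [bqj q T l n P * lag n] in [leg l]. *)
Let M n := c ^- l * qpoch (c * b) q l * qpoch (c * a) q l * qpoch q q l *
  c ^+ n * kappa n * qpoch (q ^- l) q n * qpoch (q ^+ l.+1) q n * q ^+ n /
  (qpoch q q n ^+ 2 * qpoch (c * a) q n * qpoch (c * b) q n).

Let caE : c * a = - (q / T). Proof. by rewrite mulrC acE. Qed.
Let cPaE : c * (P * a) = P * (c * a). Proof. by rewrite mulrCA. Qed.

Let qca k : qpoch (c * a) q k != 0.
Proof. by apply: qpoch_neq0 => i _; rewrite [c * a]mulrC. Qed.
Let qcb k : qpoch (c * b) q k != 0.
Proof. by apply: qpoch_neq0. Qed.
Let qcPa k : qpoch (c * (P * a)) q k != 0.
Proof. by apply: qpoch_neq0 => i _; rewrite [c * _]mulrC. Qed.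

Let MS n : M n.+1 = M n * (c * (- q ^+ n) * ((1 - q ^+ n / q ^+ l) * (1 - q ^+ n * q ^+ l.+1)) * q /
  ((1 - q ^+ n.+1) ^+ 2 * (1 + q ^+ n.+1 / T) * (1 + q ^+ n.+1 / S))).
Proof.
have e1 : 1 - c * a * q ^+ n = 1 + q ^+ n.+1 / T by rewrite caE exprS; ring.
have e2 : 1 - c * b * q ^+ n = 1 + q ^+ n.+1 / S by rewrite cbE exprS; ring.
rewrite /M kappaS !(@qpochSr _ _ _ n) e1 e2.
have := qT n.+1; have := qS n.+1; have := q1 n.
move: (1 + q ^+ n.+1 / T) (1 + q ^+ n.+1 / S) => v1 v2.
have := qq n; have := qca n; have := qcb n.
move: (qpoch _ q n) => u1; move: (qpoch _ q n) => u2; move: (qpoch _ q n) => u3.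
move: (qpoch _ q n) => u4; move: (qpoch _ q n) => u5.
rewrite !exprS => n1 n2 n3 n4 n5 n6.
by field; do ?(apply/andP; split); rewrite ?expf_neq0.
Qed.

Let M_l : M l = lin_const l.
Proof.
rewrite /lin_const leqnn subnn !qpoch0 /M.
have k1 : qpoch (q ^- l) q l * q ^+ (l * l) = kappa l * qpoch q q l.
  by have := qpochV_kappa l 0; rewrite addn0 qpoch0 mulr1 -exprM.
have := qca l; have := qcb l; have := qq l; rewrite -kappa_sqr in k1.
have ql0 : q ^+ l != 0 by rewrite expf_neq0.
have k0 : kappa l != 0.
  apply/prodf_neq0 => i _; by rewrite oppr_eq0 expf_neq0.
have {}k1 : qpoch (q ^- l) q l = qpoch q q l / (kappa l * q ^+ l).
  apply: (mulIf (mulf_neq0 (expf_neq0 2 k0) ql0)); by rewrite k1; field; do ?(apply/andP; split).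
have cl : c ^+ l != 0 by rewrite expf_neq0.
rewrite k1 expr0 divr1 => n1 n2 n3.
by field; do ?(apply/andP; split).
Qed.

(** Downward induction from n = l: [lin_constS] and [bqj_at1] give the same ratio of consecutive
    values as [MS]. *)
Let M_eq n : (n <= l)%N -> M n = lin_const n * bqj q S l n 1.
Proof.
move=> nl; rewrite -(subKn nl); move: (l - n)%N (leq_subr n l) => {nl}.
elim=> [|i IH] il.
  by rewrite subn0 bqj_l // mulr1 M_l.
have nl : (l - i.+1 < l)%N by rewrite ltn_subrL /= (leq_trans _ il).
have := IH (ltnW il); rewrite -(subnSK il); move: (l - i.+1)%N nl => {IH il i}n nl.
rewrite MS => h.
have := lin_constS n; rewrite (bqj_at1 q0 q1 S0 qS nl) /bqj_mu => hD.
have La0 : (1 - q ^+ n / q ^+ l) * (1 - q ^+ n * q ^+ l.+1) != 0 by exact: bqj_lam_factor_neq0.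
have n1 := q1 n; have n2 := qS n.+1; have n3 := qT n.+1.
have n4 : q ^+ n.+1 != 0 by rewrite expf_neq0.
have e : q ^+ n.+1 = q * q ^+ n by rewrite exprS.
move: e h hD La0 n1 n2 n3 n4.
move: ((1 - q ^+ n / q ^+ l) * _) (1 + q ^+ n.+1 / S) (1 + q ^+ n.+1 / T) => La v1 v2.
move: (lin_const n.+1) (lin_const n) (M n) (bqj q S l n.+1 1) (q ^+ n) (q ^+ n.+1).
move=> D' D M' u Z X e h hD La0 n1 n2 n3 n4.
have Z0 : Z != 0 by move: n4; rewrite e mulf_eq0 (negPf q0).
have DE : D = - D' * (s * t * r) * ((1 - X^-1) * v1) * ((1 - X^-1) * v2) / (q * La).
  by rewrite !mulNr hD; field; rewrite La0 q0.
have nz : c * - Z * La * q / ((1 - X) ^+ 2 * v2 * v1) != 0.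
  rewrite !(mulf_eq0, oppr_eq0, invr_eq0, expf_eq0) (negPf r0) (negPf s0) (negPf t0).
  by rewrite (negPf Z0) (negPf La0) (negPf q0) (negPf n1) (negPf n2) (negPf n3).
apply: (mulIf nz); rewrite h DE {hD h DE nz} /c.
rewrite {}e qE in n1 *.
by field; do ?(apply/andP; split).
Qed.

Lemma leg_connection :
  leg l = \sum_(n < l.+1) lin_coef q S T P l lin_const n 1 * lag n.
Proof.
(* [phi] is the rescaled common basis and [rn] the q-Laguerre polynomials without prefactor. [rn] is
   a q-binomial transform of [phi], and [phiE] is its inverse. *)
pose phi k := aw_basis z c q k / (qpoch (c * b) q k * qpoch (c * (P * a)) q k).
pose rn n := \sum_(k < l.+1) qpoch (q ^- n) q k / qpoch q q k * q ^+ k * phi k.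
have lagE n : (n <= l)%N -> lag n = c ^- n * (qpoch (c * b) q n * qpoch (c * (P * a)) q n) * rn n.
  move=> nl; rewrite lag_swap /aw_poly.
  have one k : qpoch (c * 0) q k = 1 by rewrite mulr0 /qpoch big1 // => i _; rewrite mul0r subr0.
  have one' k : qpoch (c * b * (P * a) * 0 / q * q ^+ n) q k = 1.
    by rewrite mulr0 !mul0r /qpoch big1 // => i _; rewrite mul0r subr0.
  rewrite one mulr1 (@aw_sum_widen _ _ _ _ _ _ _ _ _ l.+1) //; congr (_ * _).
  apply: eq_bigr => k _; rewrite /aw_term /phi one one' !mulr1.
  by field; rewrite qcb qcPa qq.
have phiE k : (k <= l)%N ->
    phi k = \sum_(n < l.+1) qpoch (q ^- k) q n / qpoch q q n * q ^+ k ^+ n * rn n.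
  move=> kl; rewrite -(@qbinomial_inversion _ q q0 q1 phi k l.+1) //.
  rewrite (big_ord_widen l.+1 (fun n => qpoch (q ^- k) q n / qpoch q q n * q ^+ k ^+ n * rn n)) //.
  rewrite big_mkcond; apply: eq_bigr => n _; case: ltnP => // kn.
  by rewrite qpoch_eq0 // !mul0r.
pose K0 := c ^- l * qpoch (c * b) q l * qpoch (c * a) q l * qpoch q q l.
pose w n k := qpoch (q ^- l) q k * qpoch (q ^+ l.+1) q k * qpoch (c * (P * a)) q k /
   (qpoch q q k ^+ 2 * qpoch (c * a) q k) * q ^+ k * (qpoch (q ^- k) q n * q ^+ k ^+ n).
(* The q-Legendre polynomial is expanded in [phi], then [phiE] is inserted and the sums are
   exchanged. *)
have legE : leg l = \sum_(n < l.+1) K0 * (rn n / qpoch q q n) * \sum_(k < l.+1) w n k.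
  rewrite leg_swap /aw_poly.
  under [RHS]eq_bigr do rewrite mulr_sumr.
  rewrite exchange_big /= cdE -/K0 mulr_sumr; apply: eq_bigr => k _.
  transitivity (K0 * (qpoch (q ^- l) q k * qpoch (q ^+ l.+1) q k * qpoch (c * (P * a)) q k /
     (qpoch q q k ^+ 2 * qpoch (c * a) q k) * q ^+ k) * phi k).
    rewrite /aw_term /phi cdE /K0.
    have -> : c * b * a * d / q * q ^+ l = q ^+ l.+1.
      rewrite (_ : c * b * a * d = (a * b) * (c * d)); last by ring.
      by rewrite abE cdE mulfK // exprS.
    by field; rewrite qcb qcPa qq qca expf_neq0.
  rewrite phiE; last by rewrite -ltnS.
  by rewrite mulr_sumr; apply: eq_bigr => n _; rewrite /w; ring.
rewrite legE; apply: eq_bigr => -[n nl] _ /=; rewrite ltnS in nl.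
(* The summands with k < n vanish. Putting k = n + j turns the others into the big q-Jacobi series
   at P = q^p, the value that belongs to m = 0. *)
have -> : \sum_(k < l.+1) w n k = kappa n * qpoch (q ^- l) q n * qpoch (q ^+ l.+1) q n *
   qpoch (c * (P * a)) q n * q ^+ n / (qpoch q q n * qpoch (c * a) q n) * bqj q T l n P.
  have lE : l.+1 = (n + (l - n).+1)%N by rewrite addnS subnKC.
  rewrite [in LHS]lE big_split_ord /= big1 ?add0r; last first.
    by move=> k _; rewrite /w (@qpoch_eq0 _ q k n q0 (ltn_ord k)) mul0r mulr0.
  rewrite /bqj.
  rewrite (bigID (fun k : 'I_l.+1 => k < (l - n).+1)%N) /= [X in _ + X]big1 ?addr0; last first.
    by move=> k; rewrite -leqNgt => nk; rewrite (bqj_coef0 T q0 nl nk) mul0r.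
  rewrite -(big_ord_widen l.+1 (fun k => bqj_coef q T l n k * qpoch (- (q ^+ n.+1 / T) * P) q k));
    last by rewrite ltnS leq_subr.
  rewrite mulr_sumr; apply: eq_bigr => j _; rewrite /w /bqj_coef.
  have k1 : qpoch (q ^- (n + j)) q n * q ^+ (n + j) ^+ n =
      kappa n * (qpoch q q n * qpoch (q ^+ n.+1) q j) / qpoch q q j.
    by rewrite exprS -qpochD -qpochV_kappa; field.
  rewrite {}k1 !qpochD -exprS exprD.
  have -> : q ^- l * q ^+ n = q ^+ n / q ^+ l by rewrite mulrC.
  have -> : q ^+ l.+1 * q ^+ n = q ^+ n * q ^+ l.+1 by rewrite mulrC.
  have -> : c * (P * a) * q ^+ n = - (q ^+ n.+1 / T) * P by rewrite cPaE caE exprS; ring.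
  have -> : c * a * q ^+ n = - (q ^+ n.+1 / T) by rewrite caE exprS; ring.
  have n1 : qpoch (q ^+ n.+1) q j != 0.
    by apply: qpoch_neq0 => i _; rewrite -exprD addSn.
  have n2 : qpoch (- (q ^+ n.+1 / T)) q j != 0.
    by apply: qpoch_neq0 => i _; rewrite mulNr opprK mulrAC -exprD.
  move: n1 n2 (qq n) (qca n) (qq j).
  move: (qpoch _ q j) (qpoch _ q j) (qpoch _ q j) (qpoch _ q j) (qpoch _ q j) (qpoch _ q j).
  move=> u1 u2 u3 u4 u5 u6 n1 n2 n3 n4 n5.
  by field; do ?(apply/andP; split).
rewrite /lin_coef mulr1 -M_eq // lagE // /M /K0.
by field; do ?(apply/andP; split); rewrite ?expf_neq0.
Qed.

Theorem legendre_laguerre_linearization m :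
  leg l * lag m =
  \sum_(0 <= n < l.+1) lin_coef q S T P l lin_const n (q ^+ m) * lag (m + n) +
  \sum_(1 <= n < l.+1 | (n <= m)%N) (\prod_(i < n) lag_down S T P (q ^+ (m - i))) *
     lin_coef q S T P l lin_const n (q ^+ (m - n)) * lag (m - n).
Proof.
have D0 n : (l < n)%N -> lin_const n = 0 by move=> ln; rewrite /lin_const leqNgt ln.
have down1 : lag_down S T P 1 = 0 by rewrite /lag_down subrr !mul0r.
apply: (@linearization_of_commuting F (z + z^-1) (leg l) l lag
  (fun k => lag_diag q S T r s t P (q ^+ k))
  (fun k => lag_down S T P (q ^+ k)) (fun n m => lin_coef q S T P l lin_const n (q ^+ m))).
- exact: lag_rec0.
- exact: lag_recS.
- exact: down1.
- move=> k; rewrite /lag_down !mulf_neq0 //.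
- by move=> n k /D0; rewrite /lin_coef => ->; rewrite !mul0r.
- move=> n k.
  have := lin_coef_commutation qE SE TE r0 s0 t0 P0 q1 qS qT D0 lin_constS n (expf_neq0 k q0).
  rewrite -exprS -!exprD ![(_ + k)%N]addnC => h; rewrite -[RHS]h.
  case: k {h} => [|k] /=; first by rewrite down1; ring.
  by rewrite [q ^+ k.+1 / q](_ : _ = q ^+ k) // exprSr mulfK.
- have -> : lag 0 = 1.
    by rewrite /lag /aw_poly !qpoch0 big_ord1 aw_term0 expr0 invr1 !mulr1.
  by rewrite mulr1 leg_connection expr0.
Qed.
End Linearization.

(** * Specialization to the complex numbers *)

Lemma askey_wilson_expE (F : numFieldType) n (z a b c d q : F) : q != 0 ->
  askey_wilson_exp n z a b c d q = aw_poly q z a b c d n.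
Proof.
move=> q0; rewrite /askey_wilson_exp /aw_poly qpochs3 (@qhyper_terminating _ _ n) //; last first.
  by rewrite inE eqxx.
congr (_ * _); apply: eq_bigr => k _.
have -> : a * b * c * d * q ^ (n%:Z - 1) = a * b * c * d / q * q ^+ n.
  by rewrite expfzDr // exprN1 -exprnP; ring.
rewrite /aw_term /aw_basis /qpochs !big_cons !big_nil !mulr1 !mulrA.
ring.
Qed.

Lemma big_q_jacobiE (R : realType) (q S y : R) (l n : nat) :
  0 < q -> S != 0 -> (n <= l)%N ->
  big_q_jacobi (l - n) n%:R n%:R (- y)%:C S 1 q = bqj q%:C S%:C l n y%:C.
Proof.
move=> q0 S0 nl.
have qC : q%:C != 0 by rewrite fmorph_eq0 gt_eqF.
rewrite /big_q_jacobi (@qhyper_terminating _ _ (l - n)) //; last by rewrite inE eqxx.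
have e1 : q%:C ^- (l - n) = q%:C ^+ n / q%:C ^+ l.
  by rewrite -[in RHS](subnKC nl) exprD; field; rewrite !expf_neq0.
have e2 : (q `^ ((l - n)%:R + n%:R + n%:R + 1))%:C = q%:C ^+ n * q%:C ^+ l.+1.
  rewrite -!natrD natr1 powR_mulrn ?ltW // rmorphXn -exprD; congr (_ ^+ _); lia.
have e3 : (q `^ (1 + n%:R))%:C = q%:C ^+ n.+1.
  by rewrite nat1r powR_mulrn ?ltW // rmorphXn.
have e4 : (q `^ (n%:R + 1))%:C = q%:C ^+ n.+1 by rewrite addrC.
rewrite {}e1 {}e2 {}e4 /bqj.
rewrite [in RHS](bigID (fun k : 'I_l.+1 => k < (l - n).+1)%N) /=.
rewrite [X in _ = _ + X]big1 ?addr0; last first.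
  by move=> k; rewrite -leqNgt => nk; rewrite bqj_coef0 ?mul0r.
rewrite -(big_ord_widen l.+1 (fun k => bqj_coef q%:C S%:C l n k *
    qpoch (- (q%:C ^+ n.+1 / S%:C) * y%:C) q%:C k));
    last by rewrite ltnS leq_subr.
apply: eq_bigr => k _; rewrite /bqj_coef /qpochs !big_cons !big_nil !mulr1.
have -> : (- (q `^ (1 + n%:R) / S))%:C = - (q%:C ^+ n.+1 / S%:C).
  by rewrite rmorphN rmorphM fmorphV /= e3.
have -> : (q `^ (1 + n%:R))%:C * (- y)%:C / S%:C = - (q%:C ^+ n.+1 / S%:C) * y%:C.
  by rewrite e3 rmorphN /=; ring.
by rewrite !mulrA; ring.
Qed.

Lemma askey_wilsonE (F : numClosedFieldType) n (x a b c d q : F) : q != 0 ->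
  askey_wilson n x a b c d q = aw_poly q (x + sqrtC (x ^+ 2 - 1)) a b c d n.
Proof. exact: askey_wilson_expE. Qed.

Lemma q_jacobiE (R : realType) n (x : R[i]) (q s t : R) : 0 < q -> 0 < s -> 0 < t ->
  q_jacobi n 0 0 x s t q = aw_poly q%:C (x + sqrtC (x ^+ 2 - 1))
    ((q `^ 2^-1)%:C * s%:C / t%:C) ((q `^ 2^-1)%:C * t%:C / s%:C)
    (- ((q `^ 2^-1)%:C / (s%:C * t%:C))) (- (s%:C * t%:C * (q `^ 2^-1)%:C)) n.
Proof.
move=> q0 s0 t0; have qC : q%:C != 0 by rewrite fmorph_eq0 gt_eqF.
have e : 2^-1 + 0 = 2^-1 :> R by rewrite addr0.
rewrite /q_jacobi e (askey_wilsonE _ _ _ _ _ _ qC); move: (q `^ 2^-1) => r.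
by rewrite 2!rmorphN !rmorphM !fmorphV rmorphM.
Qed.

Lemma q_laguerreE (R : realType) n p (x : R[i]) (q s t : R) : 0 < q -> 0 < s -> 0 < t ->
  q_laguerre n p%:R x s t q = aw_poly q%:C (x + sqrtC (x ^+ 2 - 1))
    ((q ^+ p)%:C * ((q `^ 2^-1)%:C * s%:C / t%:C)) ((q `^ 2^-1)%:C * t%:C / s%:C)
    (- ((q `^ 2^-1)%:C / (s%:C * t%:C))) 0 n.
Proof.
move=> q0 s0 t0; have qC : q%:C != 0 by rewrite fmorph_eq0 gt_eqF.
have e : q `^ (2^-1 + p%:R) = q ^+ p * q `^ 2^-1.
  by rewrite powRD ?(gt_eqF q0) ?implybT // powR_mulrn ?ltW // mulrC.
rewrite /q_laguerre e (askey_wilsonE _ _ _ _ _ _ qC); move: (q `^ 2^-1) (q ^+ p) => r P.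
by rewrite rmorphN !rmorphM !fmorphV rmorphM /= -!mulrA.
Qed.

Lemma qpochC (R : realType) (a q : R) k : (qpoch a q k)%:C = qpoch a%:C q%:C k.
Proof.
by rewrite /qpoch rmorph_prod; apply: eq_bigr => i _; rewrite rmorphB rmorphM rmorphXn rmorph1.
Qed.

Lemma linearization_coefE (R : realType) (q tau sigma : R) n l : 0 < q -> (n <= l)%N ->
  (linearization_coef q n l tau sigma)%:C =
  lin_const q%:C ((q `^ tau)%:C ^+ 2) ((q `^ sigma)%:C ^+ 2) (q `^ 2^-1)%:C (q `^ tau)%:C
    (q `^ sigma)%:C l n.
Proof.
move=> q0 nl.
have qn0 : (q == 0) = false by rewrite gt_eqF.
have powq k : q `^ k%:R = q ^+ k by rewrite powR_mulrn // ltW.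
have powqr (u : R) k : q `^ (u * k%:R) = (q `^ u) ^+ k.
  by rewrite powRrM powR_mulrn // powR_ge0.
have e1 u : q `^ (2 * u - l%:R) = (q `^ u) ^+ 2 / q ^+ l.
  by rewrite powRB ?qn0 ?implybT // powq [2 * u]mulrC powqr.
have e2 : q `^ (2^-1 * (l - n)%:R * ((l - n)%:R - 2 * sigma - 2 * tau)) =
   (q `^ 2^-1) ^+ ((l - n) ^ 2) / (q `^ tau * q `^ sigma) ^+ (l - n).
  rewrite (_ : _ * _ * _ = 2^-1 * ((l - n) ^ 2)%:R - (tau + sigma) * (l - n)%:R).
    by rewrite powRB ?qn0 ?implybT // !powqr powRD ?qn0 ?implybT.
  by rewrite natrX; field.
rewrite /linearization_coef /lin_const nl /qpochs !big_cons big_nil mulr1 !e1 e2 !addn1.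
rewrite !(rmorphM, fmorphV) /= !qpochC !(rmorphN, rmorphM, rmorphXn, fmorphV) /=.
by ring.
Qed.

Theorem theorem4p1 (R : realType) (q : R) (hq0 : 0 < q) (hq1 : q < 1)
    (l m p : nat) (sigma tau : R) (x : R[i]) :
  q_jacobi l 0 0 x (q `^ tau) (q `^ sigma) q *
  q_laguerre m p%:R x (q `^ tau) (q `^ sigma) q =
  \sum_(0 <= n < l.+1)
     (linearization_coef q n l tau sigma)%:C *
     big_q_jacobi (l - n) n%:R n%:R (- q ^+ m)%:C (q `^ (2 * tau)) 1 q *
     big_q_jacobi (l - n) n%:R n%:R (- q ^+ (m + p))%:C (q `^ (2 * sigma)) 1 q *
     q_laguerre (m + n) p%:R x (q `^ tau) (q `^ sigma) q
  + \sum_(1 <= n < l.+1 | (n <= m)%N)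
     (linearization_coef q n l tau sigma)%:C *
     (qpochs [:: q ^+ m; q ^+ (m + p); - q `^ ((m + p)%:R - 2 * sigma);
                 - q `^ (m%:R - 2 * tau)] q^-1 n)%:C *
     big_q_jacobi (l - n) n%:R n%:R (- q ^+ (m - n))%:C (q `^ (2 * tau)) 1 q *
     big_q_jacobi (l - n) n%:R n%:R (- q ^+ (m + p - n))%:C (q `^ (2 * sigma)) 1 q *
     q_laguerre (m - n) p%:R x (q `^ tau) (q `^ sigma) q.
Proof.
set z := x + sqrtC (x ^+ 2 - 1).
(* The inverse of z is the other root, x - sqrt(x^2 - 1). *)
have z0 : z != 0.
  apply/eqP => z0; have : z * (x - sqrtC (x ^+ 2 - 1)) = 1.
    by rewrite mulrC /z -subr_sqr sqrtCK opprB addrC subrK.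
  by rewrite z0 mul0r => /esym/eqP; rewrite oner_eq0.
pose r := q `^ 2^-1; pose s := q `^ tau; pose t := q `^ sigma; pose P := q ^+ p.
have r0 : 0 < r by exact: powR_gt0.
have s0 : 0 < s by exact: powR_gt0.
have t0 : 0 < t by exact: powR_gt0.
have P0 : 0 < P by exact: exprn_gt0.
have qE : q = r ^+ 2.
  by rewrite -powR_mulrn ?powR_ge0 // -powRrM mulVf ?pnatr_eq0 // powRr1 // ltW.
have SE : q `^ (2 * tau) = s ^+ 2 by rewrite -powR_mulrn ?powR_ge0 // -powRrM mulrC.
have TE : q `^ (2 * sigma) = t ^+ 2 by rewrite -powR_mulrn ?powR_ge0 // -powRrM mulrC.
have qn k : q ^+ k.+1 < 1 by rewrite exprn_ilt1 // ltW.
have qn0 k : 0 < q ^+ k by exact: exprn_gt0.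
have neC (u : R) : u != 0 -> u%:C != 0 by rewrite fmorph_eq0.
have jacE := q_jacobiE l x hq0 s0 t0.
have lagE n := q_laguerreE n p x hq0 s0 t0.
have lE n : (n <= l)%N -> (linearization_coef q n l tau sigma)%:C =
    lin_const q%:C (s%:C ^+ 2) (t%:C ^+ 2) r%:C s%:C t%:C l n.
  by move=> nl; rewrite linearization_coefE //.
(* The i-th factors of the four Pochhammer symbols in base 1/q multiply to [lag_down] at q^(m-i); n
   <= m keeps m - i from being truncated. *)
have dE n : (n <= m)%N ->
    (qpochs [:: q ^+ m; q ^+ (m + p); - q `^ ((m + p)%:R - 2 * sigma);
       - q `^ (m%:R - 2 * tau)] q^-1 n)%:C =
    \prod_(i < n) lag_down (s%:C ^+ 2) (t%:C ^+ 2) P%:C (q%:C ^+ (m - i)).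
  move=> nm; rewrite /qpochs !big_cons big_nil mulr1 /qpoch -!big_split rmorph_prod.
  apply: eq_bigr => -[i il] _ /=.
  have im : (i <= m)%N by apply: leq_trans (ltnW il) nm.
  have e1 : q ^+ m * q^-1 ^+ i = q ^+ (m - i) by rewrite exprVn exprB // unitfE gt_eqF.
  have e2 : q ^+ (m + p) = P * q ^+ m by rewrite exprD mulrC.
  have powq k : q `^ k%:R = q ^+ k by rewrite powR_mulrn // ltW.
  have e3 : q `^ ((m + p)%:R - 2 * sigma) = P * q ^+ m / t ^+ 2.
    by rewrite powRB ?(gt_eqF hq0) ?implybT // TE powq e2.
  have e4 : q `^ (m%:R - 2 * tau) = q ^+ m / s ^+ 2.
    by rewrite powRB ?(gt_eqF hq0) ?implybT // SE powq.
  have e5 u : P * q ^+ m / u * q^-1 ^+ i = P * q ^+ (m - i) / u by rewrite -e1; ring.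
  have e6 u : q ^+ m / u * q^-1 ^+ i = q ^+ (m - i) / u by rewrite -e1; ring.
  rewrite e3 e4 e2 !mulNr !opprK e5 e6 e1 -[P * q ^+ m * _]mulrA e1.
  rewrite /lag_down !(rmorphM, rmorphD, rmorphN, rmorph1, rmorphXn, fmorphV) /=.
  by ring.
rewrite jacE lagE.
have qC k : (q ^+ k)%:C = q%:C ^+ k by rewrite rmorphXn.
have qpC k : (q ^+ (k + p))%:C = P%:C * q%:C ^+ k
  by rewrite -qC -rmorphM /= mulrC -exprD.
have s2C (u : R) : (u ^+ 2)%:C = u%:C ^+ 2 by rewrite rmorphXn.
have lt0C (u : R) : 0 < u -> u%:C != 0 by move=> u0; rewrite neC ?gt_eqF.
rewrite (@legendre_laguerre_linearization R[i] q%:C (s%:C ^+ 2) (t%:C ^+ 2)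
  r%:C s%:C t%:C P%:C z l) //.
- congr (_ + _).
    apply: eq_big_nat => n /andP[_]; rewrite ltnS => nl.
    rewrite lE // !big_q_jacobiE ?gt_eqF ?powR_gt0 // SE TE -/s -/t lagE.
    by rewrite qpC qC !s2C.
  rewrite big_nat_cond [RHS]big_nat_cond; apply: eq_bigr => n /andP[/andP[_ nl] nm].
  rewrite ltnS in nl.
  rewrite lE // dE // !big_q_jacobiE ?gt_eqF ?powR_gt0 // SE TE -/s -/t lagE.
  (* Since n <= m, m + p - n is (m - n) + p, so the second argument is P times the first. *)
  by rewrite -addnBAC // qpC qC !s2C /lin_coef; ring.
- by rewrite qE rmorphXn.
- exact: lt0C.
- exact: lt0C.
- exact: lt0C.
- exact: lt0C.
(* The remaining nonvanishing conditions hold for reals, by positivity and q^(k+1) < 1, and carry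
   over to the complex numbers. *)
- move=> k; have -> : 1 - q%:C ^+ k.+1 = (1 - q ^+ k.+1)%:C.
    by rewrite rmorphB rmorphXn rmorph1.
  by rewrite lt0C // subr_gt0.
- move=> k; have -> : 1 + q%:C ^+ k / s%:C ^+ 2 = (1 + q ^+ k / s ^+ 2)%:C.
    by rewrite !(rmorphD, rmorphM, fmorphV, rmorphXn, rmorph1).
  by rewrite lt0C // addr_gt0 // divr_gt0 // exprn_gt0.
- move=> k; have -> : 1 + q%:C ^+ k / t%:C ^+ 2 = (1 + q ^+ k / t ^+ 2)%:C.
    by rewrite !(rmorphD, rmorphM, fmorphV, rmorphXn, rmorph1).
  by rewrite lt0C // addr_gt0 // divr_gt0 // exprn_gt0.
- move=> k; have -> : 1 + q%:C ^+ k * s%:C ^+ 2 = (1 + q ^+ k * s ^+ 2)%:C.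
    by rewrite !(rmorphD, rmorphM, rmorphXn, rmorph1).
  by rewrite lt0C // addr_gt0 // mulr_gt0 // exprn_gt0.
- move=> k; have -> : 1 - P%:C * q%:C ^+ k.+1 = (1 - q ^+ (p + k.+1))%:C.
    by rewrite rmorphB rmorph1 /= [(p + _)%N]addnC qpC.
  by rewrite lt0C // addnS subr_gt0.
- move=> k; have -> : 1 + P%:C * q%:C ^+ k / t%:C ^+ 2 = (1 + P * q ^+ k / t ^+ 2)%:C.
    by rewrite !(rmorphD, rmorphM, fmorphV, rmorphXn, rmorph1).
  by rewrite lt0C // addr_gt0 // divr_gt0 ?mulr_gt0 // exprn_gt0.
Qed.
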